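(* Let $m>0$. For $g\in C_c^\infty(\mathbb{R}^2)$ with $g\ge0$, let $S(g)$ be the Bogoliubov operator of the $(:\phi^4:)_2$ theory, i.e. $S(g)=\operatorname*{s-lim}_{t\to+\infty,\,s\to-\infty}U_g^D(t,s)$. Then: (i) $S(g)$ is unitary: $S(g)^{-1}=S(g)^*$; (ii) if $g_1,g_2\in C_c^\infty(\mathbb{R}^2)$ with $g_1,g_2\ge0$ have supports such that $t_1>t_2$ for all $(x_1,t_1)\in\operatorname{supp}g_1$ and all $(x_2,t_2)\in\operatorname{supp}g_2$, then $$S(g_1+g_2)=S(g_1)S(g_2).$$
   Context: $\mathcal{F}$ is the symmetric (bosonic) Fock space over $L^2(\mathbb{R},dk)$, with annihilation and creation operators satisfying $[a(k),a^*(k')]=\delta(k-k')$. Let $\omega(k)=(k^2+m^2)^{1/2}$ and $H_0=\int\omega(k)a^*(k)a(k)\,dk$. The time-zero free field of mass $m$ in one space dimension is $$\phi(x)=\phi(x,0)=(4\pi)^{-1/2}\int e^{-ikx}\,[a^*(k)+a(-k)]\,\omega(k)^{-1/2}\,dk .$$ The interaction is $V_g(t)=\int dx\,g(x,t):\phi^4(x,0):$ (Wick ordering), defined on $D_0=\bigcap_{n\ge0}D(H_0^n)$, on which it has a unique self-adjoint closure, also denoted $V_g(t)$. Here $(x,t)\in\mathbb{R}^2$ with $x$ the space and $t$ the time variable. Known facts (Glimm–Jaffe): $H_g(t)=H_0+V_g(t)$ is self-adjoint on $D(H_0)\cap D(V_g(t))$, essentially self-adjoint on $D_0$, and there is $0<M_g<\infty$,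 independent of $t$, with $H_g(t)\ge-M_g\mathbf{1}$. Fix $c>0$, put $M=M_g+c$ and $\tilde H(t)=H_g(t)+M\mathbf{1}\ge c\mathbf{1}$. $U_g(t,s)$, $s\le t$, denotes the unique two-parameter family of unitary operators on $\mathcal{F}$ with $U_g(t,s)U_g(s,r)=U_g(t,r)$ for $r\le s\le t$, $U_g(t,t)=\mathbf{1}$, $U_g(t,s)D(\tilde H(s))\subset D(\tilde H(t))$, and $i\frac{\partial}{\partial t}U_g(t,s)\Psi=\tilde H(t)U_g(t,s)\Psi$ for $\Psi\in D(\tilde H(s))$ (its existence is a result of the paper, taken as given for this statement). The interaction-picture propagator is $U_g^D(t,s)=e^{i(H_0+M)t}U_g(t,s)e^{-i(H_0+M)s}$. *)

(* Defs.v *)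
From HB Require Import structures.
From mathcomp Require Import all_boot all_order all_algebra.
From mathcomp Require Import all_classical all_reals all_analysis.
From mathcomp Require Import measurable_realfun complex.

Set Implicit Arguments.
Unset Strict Implicit.
Unset Printing Implicit Defensive.
Import Order.TTheory GRing.Theory Num.Theory.
Import numFieldNormedType.Exports.

Local Open Scope classical_set_scope.
Local Open Scope ring_scope.
Local Open Scope complex_scope.

HB.instance Definition _ (T : choiceType) := isPointed.Build (seq T) [::].

(* The Fock space is realized as an L^2 space over the space of finite
   momentum configurations (k_1, ..., k_n), n >= 0. *)
Section Config.
Context (R : realType).

(* Generators of the sigma-algebra on finite sequences which makes the length
   and all coordinates measurable, i.e. of the disjoint union of the Borel
   sigma-algebras of the R^n. *)
Definition config_gen : set_system (seq R) :=
  [set A | (exists n, A = [set s | size s = n]) \/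
           (exists i (B : set (measurableTypeR R)),
              measurable B /\ A = [set s | B (nth 0 s i)])].

Definition config := g_sigma_algebraType config_gen.

Definition cons_config (ks : measurableTypeR R * config) : config :=
  ks.1 :: ks.2.

Lemma measurable_config_size n : measurable ([set s | size s = n] : set config).
Proof. by apply: sub_sigma_algebra; left; exists n. Qed.

Lemma measurable_nth i :
  measurable_fun setT (fun s : config => nth 0 s i : measurableTypeR R).
Proof.
move=> _ B mB; rewrite setTI.
by apply: sub_sigma_algebra; right; exists i, B.
Qed.

Lemma measurable_to_config d (T : measurableType d) (f : T -> config) :
  (forall n, measurable [set x | size (f x) = n]) ->
  (forall i, measurable_fun setT (fun x => nth 0 (f x) i : measurableTypeR R)) ->
  measurable_fun setT f.
Proof.
move=> msz mnth; apply: (@measurability _ _ _ _ setT f config_gen) => //.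
move=> _ [A [[n ->]|[i [B [mB ->]]]] <-]; rewrite setTI; first exact: msz.
by rewrite -[X in measurable X]setTI; exact: mnth.
Qed.

Lemma measurable_cons_config : measurable_fun setT cons_config.
Proof.
apply: measurable_to_config => [[|n]|[|i]] /=.
- by rewrite (_ : [set _ | _] = set0)//; apply/seteqP; split.
- have -> : [set x : measurableTypeR R * config | (size x.2).+1 = n.+1] =
      snd @^-1` ([set s | size s = n] : set config).
    by apply/seteqP; split => x /= [->].
  rewrite -[X in measurable X]setTI.
  by apply: measurable_snd => //; exact: measurable_config_size.
- exact: measurable_fst.
- by apply: (measurableT_comp (measurable_nth i)); exact: measurable_snd.
Qed.

Lemma measurable_behead :
  measurable_fun setT (fun s : config => behead s : config).
Proof.
apply: measurable_to_config => [n|i].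
- have -> : [set s : config | size (behead s) = n] =
    [set s | size s = n.+1] `|` (if n is 0%N then [set s | size s = 0%N] else set0).
    apply/seteqP; split => [[|a s]|[|a s]] /=.
    + by move=> <-; right.
    + by move=> ->; left.
    + by case: n => [|n] //= [].
    + by case=> [[->]|] //; case: n.
  apply: measurableU; first exact: measurable_config_size.
  by case: n => [|n]; [exact: measurable_config_size|].
- rewrite (_ : (fun x : config => _) = (fun s : config => nth 0 s i.+1)).
    exact: measurable_nth.
  by apply/funext => s; rewrite nth_behead.
Qed.

Section ConsMeasure.
Variable mu : {sigma_finite_measure set config -> \bar R}.

Definition cons_measure : set config -> \bar R :=
  pushforward (@lebesgue_measure R \x mu)%E cons_config.

Let mpre A : measurable A -> measurable (cons_config @^-1` A).
Proof.
by move=> mA; rewrite -[X in measurable X]setTI; exact: measurable_cons_config.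
Qed.

Let cm0 : cons_measure set0 = 0%E.
Proof. by rewrite /cons_measure /pushforward preimage_set0 measure0. Qed.

Let cm_ge0 A : (0 <= cons_measure A)%E.
Proof. by rewrite /cons_measure /pushforward measure_ge0. Qed.

Let cm_sa : semi_sigma_additive cons_measure.
Proof.
move=> F mF tF mUF; rewrite /cons_measure /pushforward preimage_bigcup.
apply: measure_semi_sigma_additive.
- by move=> n; exact: mpre.
- apply/trivIsetP => /= i j _ _ ij; rewrite -preimage_setI.
  by move/trivIsetP : tF => /(_ _ _ _ _ ij) ->//; rewrite preimage_set0.
- by rewrite -preimage_bigcup; exact: mpre.
Qed.

HB.instance Definition _ :=
  isMeasure.Build _ _ _ cons_measure cm0 cm_ge0 cm_sa.

Let cm_sigma_finite : sigma_finite setT cons_measure.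
Proof.
have /sigma_finiteP[F [TF ndF Foo]] := sigma_finiteT (@lebesgue_measure R).
have /sigma_finiteP[G [TG ndG Goo]] := sigma_finiteT mu.
pose B n := [set s : config | size s = 0%N] `|`
  ([set s | F n (nth 0 s 0%N)] `&` [set s | G n (behead s)]).
exists B.
  apply/seteqP; split => // s _.
  have : [set: measurableTypeR R] (nth 0 s 0%N) by [].
  have : [set: config] (behead s : config) by [].
  rewrite TF TG => -[n _ Gn] [k _ Fk]; exists (maxn n k) => //; right; split => /=.
    by move: (nth _ _ _) Fk; move=> x; apply/subsetPset; apply: ndF; exact: leq_maxr.
  by move: (behead s) Gn; move=> x; apply/subsetPset; apply: ndG; exact: leq_maxl.
move=> n; have [mF Fn] := Foo n; have [mG Gn] := Goo n; split.
  apply: measurableU; first exact: measurable_config_size.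
  apply: measurableI.
    by rewrite -[X in measurable X]setTI; exact: measurable_nth.
  by rewrite -[X in measurable X]setTI; exact: measurable_behead.
rewrite /cons_measure /pushforward (_ : _ @^-1` _ = F n `*` G n).
  rewrite product_measure1E// lte_mul_pinfty// ge0_fin_numE//.
by apply/seteqP; split => -[k s] /=; [case|right].
Qed.

HB.instance Definition _ :=
  Measure_isSigmaFinite.Build _ _ _ cons_measure cm_sigma_finite.
End ConsMeasure.

(* n-dimensional Lebesgue measure, carried by the sequences of length n. *)
Fixpoint lebesgue_config n : {sigma_finite_measure set config -> \bar R} :=
  if n is n'.+1 then cons_measure (lebesgue_config n') else \d_([::] : config).

(* With the weight 1/n! on the n-particle sector, a wave function psi is n!^(1/2)
   times the usual one, and the ladder operators lose their square roots:
     (a(k) psi)(s) = psi(k :: s),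
     (a*(f) psi)(s) = \sum_i f(s_i) psi(s without s_i).
   They are adjoint to each other and satisfy [a(k), a*(k')] = delta(k - k'). *)
Definition fock_measure : {measure set config -> \bar R} :=
  mseries (fun n => mscale (n`!%:R^-1)%:nng (lebesgue_config n)) 0.
End Config.

Section Fock.
Context (R : realType).
Local Notation C := R[i].
Local Notation config := (config R).
Local Notation mu := (fock_measure R).
Local Notation normc := (@Normc.normc R).
Local Notation N2 f := ('N[mu]_2%:E[EFin \o (fun s => normc (f s))])%E.

(* Square integrable symmetric wave functions. Every class of almost everywhere
   symmetric functions has a representative which is symmetric everywhere. *)
Definition is_fock (f : config -> C) : Prop :=
  [/\ measurable_fun setT (fun s => complex.Re (f s)),
      measurable_fun setT (fun s => complex.Im (f s)),
      (forall s t : seq R, perm_eq s t -> f s = f t)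
    & finite_norm mu 2%:E (fun s => normc (f s))].

Definition fockfun_pred : {pred (config -> C)} := mem [set f | is_fock f].

Let le12 : (1 <= 2%:E :> \bar R)%E.
Proof. by rewrite lee_fin ler1n. Qed.

Lemma measurable_normc (f : config -> C) :
  measurable_fun setT (fun s => complex.Re (f s)) ->
  measurable_fun setT (fun s => complex.Im (f s)) ->
  measurable_fun setT (fun s => normc (f s)).
Proof.
move=> mr mi.
rewrite (_ : (fun s => _) =
  (fun s => Num.sqrt (complex.Re (f s) ^+ 2 + complex.Im (f s) ^+ 2))); last first.
  by apply/funext => s; case: (f s).
apply: measurableT_comp => //.
  by apply: continuous_measurable_fun; exact: sqrt_continuous.
by apply: measurable_funD; apply: measurable_funX.
Qed.

Lemma normc_ge0 (x : C) : 0 <= normc x.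
Proof. by case: x => a b; exact: sqrtr_ge0. Qed.

Lemma N2D (f g : config -> C) :
  measurable_fun setT (fun s => complex.Re (f s)) ->
  measurable_fun setT (fun s => complex.Im (f s)) ->
  measurable_fun setT (fun s => complex.Re (g s)) ->
  measurable_fun setT (fun s => complex.Im (g s)) ->
  measurable_fun setT (fun s => complex.Re ((f + g) s)) ->
  measurable_fun setT (fun s => complex.Im ((f + g) s)) ->
  (N2 (f + g)%R <= N2 f + N2 g)%E.
Proof.
move=> fr fi gr gi fgr fgi.
have mf := measurable_normc fr fi; have mg := measurable_normc gr gi.
apply: le_trans (eminkowski mu mf mg le12).
rewrite unlock /Lnorm; apply: gt0_ler_poweR.
- by rewrite invr_ge0.
- by rewrite in_itv/= leey andbT integral_ge0// => s _; exact: poweR_ge0.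
- by rewrite in_itv/= leey andbT integral_ge0// => s _; exact: poweR_ge0.
apply: ge0_le_integral => //.
- by move=> s ?; exact: poweR_ge0.
- apply: (measurableT_comp (measurable_poweR _)).
  by apply: measurableT_comp => //; apply/measurable_EFinP; exact: measurable_normc.
- apply: (measurableT_comp (measurable_poweR _)).
  apply: measurableT_comp => //; apply/measurable_EFinP.
  exact: measurable_funD.
move=> s _; apply: gt0_ler_poweR => //=.
- by rewrite in_itv/= leey andbT lee_fin.
- by rewrite in_itv/= leey andbT lee_fin.
by rewrite lee_fin !ger0_norm ?addr_ge0 ?normc_ge0//; exact: le_normcD.
Qed.

Lemma N2Z (a : C) (f : config -> C) : is_fock f ->
  (N2 (a *: f)%R = (normc a)%:E * N2 f)%E.
Proof.
move=> [fr fi _ fn].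
have mf : (fun s => normc (f s)) \in Lfun mu 2%:E.
  by apply/andP; rewrite !inE; split => //; exact: measurable_normc.
rewrite -[normc a]ger0_norm ?normc_ge0// -(LnormZ (Lfun_Sub le12 mf)).
apply: eq_Lnorm => s /=.
by congr EFin; rewrite [RHS]/GRing.scale/= -Normc.normcM.
Qed.

Lemma fockfun_submod_closed : submod_closed fockfun_pred.
Proof.
split=> [|a f g].
  rewrite inE; split => //=.
  rewrite /finite_norm (_ : EFin \o _ = cst 0%E).
    by rewrite Lnorm0// ?ltry// eqe pnatr_eq0.
  by apply/funext => s /=; rewrite expr0n /= addr0 sqrtr0.
rewrite !inE => -[fr fi fs fn] [gr gi gs gn].
have zr : measurable_fun setT (fun s => complex.Re ((a *: f) s)).
  rewrite (_ : (fun s => _) = (fun s =>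
    complex.Re a * complex.Re (f s) - complex.Im a * complex.Im (f s))).
    by apply: measurable_funB; exact: measurable_funM.
  by apply/funext => s /=; rewrite !fctE; case: (a) (f s) => [? ?] [? ?].
have zi : measurable_fun setT (fun s => complex.Im ((a *: f) s)).
  rewrite (_ : (fun s => _) = (fun s =>
    complex.Re a * complex.Im (f s) + complex.Im a * complex.Re (f s))).
    by apply: measurable_funD; exact: measurable_funM.
  by apply/funext => s /=; rewrite !fctE; case: (a) (f s) => [? ?] [? ?].
have sr : measurable_fun setT (fun s => complex.Re ((a *: f + g) s)).
  rewrite (_ : (fun s => _) =
    (fun s => complex.Re ((a *: f) s) + complex.Re (g s))).
    exact: measurable_funD.
  by apply/funext => s /=; rewrite !fctE; case: (a *: f s) (g s) => [? ?] [? ?].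
have si : measurable_fun setT (fun s => complex.Im ((a *: f + g) s)).
  rewrite (_ : (fun s => _) =
    (fun s => complex.Im ((a *: f) s) + complex.Im (g s))).
    exact: measurable_funD.
  by apply/funext => s /=; rewrite !fctE; case: (a *: f s) (g s) => [? ?] [? ?].
split => //.
  by move=> s t st; rewrite !fctE (fs _ _ st) (gs _ _ st).
apply: le_lt_trans (N2D zr zi gr gi sr si) _.
by rewrite N2Z// lte_add_pinfty// lte_mul_pinfty// lee_fin normc_ge0.
Qed.

HB.instance Definition _ :=
  GRing.isSubmodClosed.Build _ _ fockfun_pred fockfun_submod_closed.

Record fockfun := FockFun { fockfun_val :> config -> C;
                            _ : fockfun_val \in fockfun_pred }.
HB.instance Definition _ := [isSub for fockfun_val].
HB.instance Definition _ := [Choice of fockfun by <:].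
HB.instance Definition _ := [SubChoice_isSubLmodule of fockfun by <:].

Lemma fockfunP (f : fockfun) : is_fock f.
Proof. by case: f => f /=; rewrite inE. Qed.

Definition null_pred : {pred fockfun} :=
  mem [set f : fockfun | \forall s \ae mu, (f : config -> C) s = 0].

Lemma null_submod_closed : submod_closed null_pred.
Proof.
split=> [|a f g]; rewrite !inE /=; first by apply: nearW => s.
move=> f0 g0; near=> s.
transitivity (a *: (f : config -> C) s + (g : config -> C) s) => //.
have -> : (f : config -> C) s = 0 by near: s.
have -> : (g : config -> C) s = 0 by near: s.
by rewrite addr0 scaler0.
Unshelve. all: by end_near.
Qed.

HB.instance Definition _ :=
  GRing.isSubmodClosed.Build _ _ null_pred null_submod_closed.

Local Open Scope quotient_scope.

(* The symmetric Fock space over L^2(R, dk): wave functions modulo equality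
   almost everywhere. *)
Definition fock := @Quotient.quot fockfun null_pred.
HB.instance Definition _ := Choice.on fock.
HB.instance Definition _ := EqQuotient.on fock.
HB.instance Definition _ := GRing.Zmodule.on fock.

(* A chosen representative. *)
Definition wavefun (psi : fock) : fockfun := repr psi.

Definition fockscale (a : C) (psi : fock) : fock := \pi_fock (a *: wavefun psi).

Lemma fock_eqP (f g : fockfun) :
  reflect (\forall s \ae mu, (f : config -> C) s = (g : config -> C) s)
          (\pi_fock f == \pi_fock g).
Proof.
rewrite piE Quotient.equivE; apply: (iffP idP); rewrite inE /=.
  by apply: filterS => s /eqP; rewrite subr_eq0 => /eqP.
by apply: filterS => s fg; apply/eqP; rewrite subr_eq0; apply/eqP.
Qed.

Lemma wavefunK (f : fockfun) :
  \forall s \ae mu, (wavefun (\pi_fock f) : config -> C) s = (f : config -> C) s.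
Proof. by apply/fock_eqP; rewrite /wavefun reprK. Qed.

Lemma pi_fockZ a (f : fockfun) : \pi_fock (a *: f) = fockscale a (\pi_fock f).
Proof.
apply/eqP/fock_eqP; move: (wavefunK f); apply: filterS => s ws.
transitivity (a *: (wavefun (\pi_fock f) : config -> C) s) => //.
by rewrite ws.
Qed.

Lemma pi_fockD (f g : fockfun) : \pi_fock (f + g) = \pi_fock f + \pi_fock g.
Proof. by rewrite !piE. Qed.

Let fockscaleA a b psi :
  fockscale a (fockscale b psi) = fockscale (a * b) psi.
Proof. by rewrite -[psi]reprK -(pi_fockZ b) -(pi_fockZ a) -(pi_fockZ (a * b)) scalerA. Qed.

Let fockscale1 : left_id 1 fockscale.
Proof. by move=> psi; rewrite -[psi]reprK -(pi_fockZ 1) scale1r. Qed.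

Let fockscaleDr : right_distributive fockscale +%R.
Proof.
move=> a x y; rewrite -[x]reprK -[y]reprK.
by rewrite -pi_fockD -!(pi_fockZ a) -pi_fockD scalerDr.
Qed.

Let fockscaleDl psi : {morph fockscale^~ psi : a b / a + b}.
Proof.
by move=> a b; rewrite -[psi]reprK -(pi_fockZ a) -(pi_fockZ b)
  -(pi_fockZ (a + b)) -pi_fockD scalerDl.
Qed.

HB.instance Definition _ := GRing.Zmodule_isLmodule.Build C fock
  fockscaleA fockscale1 fockscaleDr fockscaleDl.

Definition fock_norm (psi : fock) : C := (fine (N2 (wavefun psi)))%:C.

Lemma N2fin (f : fockfun) : N2 f \is a fin_num.
Proof.
have [_ _ _ h] := fockfunP f.
by rewrite fin_numElt (lt_le_trans ltNy0) ?Lnorm_ge0.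
Qed.

Lemma N2_ae (f g : fockfun) :
  (\forall s \ae mu, (f : config -> C) s = (g : config -> C) s) -> N2 f = N2 g.
Proof.
have [fr fi _ _] := fockfunP f; have [gr gi _ _] := fockfunP g.
move=> fg; rewrite unlock /Lnorm; congr (_ `^ _)%E.
have mN (h : fockfun) : measurable_fun setT
   (fun s => `|(normc (h s))%:E| `^ 2)%E.
  have [hr hi _ _] := fockfunP h.
  apply: (measurableT_comp (measurable_poweR _)).
  by apply: measurableT_comp => //; apply/measurable_EFinP; exact: measurable_normc.
apply: ae_eq_integral => //; [exact: mN|exact: mN|].
by move: fg; apply: filterS => s /= -> _.
Qed.

Lemma fock_normE (f : fockfun) : fock_norm (\pi_fock f) = (fine (N2 f))%:C.
Proof. by rewrite /fock_norm (N2_ae (wavefunK f)). Qed.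

Let fock_normD x y : fock_norm (x + y) <= fock_norm x + fock_norm y.
Proof.
rewrite -[x]reprK -[y]reprK -pi_fockD !fock_normE -rmorphD lecR.
rewrite -fineD ?N2fin// fine_le ?fin_numD ?N2fin//.
have [fr fi _ _] := fockfunP (repr x); have [gr gi _ _] := fockfunP (repr y).
have [sr si _ _] := fockfunP (repr x + repr y).
exact: N2D.
Qed.

Let fock_normZ a x : fock_norm (a *: x) = `|a| * fock_norm x.
Proof.
rewrite -[x]reprK [LHS](_ : _ = fock_norm (\pi_fock (a *: repr x))); last first.
  by rewrite pi_fockZ.
rewrite !fock_normE (N2Z a (fockfunP (repr x))) fineM ?N2fin//=.
by rewrite rmorphM; congr *%R; case: (a).
Qed.

Let fock_norm0_eq0 x : fock_norm x = 0 -> x = 0.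
Proof.
rewrite -[x]reprK fock_normE => -[] h.
have {h} N0 : N2 (repr x) = 0%E by rewrite -[LHS]fineK ?N2fin// h.
rewrite -[RHS](_ : \pi_fock 0 = _); last by rewrite piE.
apply/eqP/fock_eqP.
have [fr fi _ _] := fockfunP (repr x).
have mN : measurable_fun setT
    (EFin \o (fun s => normc ((repr x : fockfun) s))).
  by apply/measurable_EFinP; exact: measurable_normc.
have two_gt0 : (0 < 2%:E :> \bar R)%E by rewrite lte_fin.
apply: filterS (Lnorm_eq0_eq0 mN two_gt0 N0) => s /(_ I) [] h.
exact: Normc.eq0_normc.
Qed.

HB.instance Definition _ := @Lmodule_isNormed.Build C fock
  fock_norm fock_normD fock_normZ fock_norm0_eq0.

End Fock.

Section Operators.
Context (R : realType).
Local Notation C := R[i].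
Local Notation config := (config R).
Local Notation fock := (fock R).
Local Notation mu := (fock_measure R).
Local Open Scope quotient_scope.

Definition cintegral d (T : measurableType d) (nu : {measure set T -> \bar R})
    (f : T -> C) : C :=
  Rintegral nu setT (fun x => complex.Re (f x)) +i*
  Rintegral nu setT (fun x => complex.Im (f x)).

(* Linear in the second argument. *)
Definition inner (phi psi : fock) : C :=
  cintegral mu (fun s => (wavefun phi s)^* * wavefun psi s).

Definition is_adjoint (A B : fock -> fock) : Prop :=
  forall phi psi, inner phi (A psi) = inner (B phi) psi.

(* A is a unitary operator: A^-1 = A^*. *)
Definition unitary (A : fock -> fock) : Prop :=
  linear A /\ exists B, [/\ is_adjoint A B, cancel A B & cancel B A].

(* Unbounded operators are given by their graphs. *)
Definition operator := set (fock * fock).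

Definition dom (A : operator) : set fock := [set psi | exists chi, A (psi, chi)].

(* The domain of A^n. *)
Fixpoint dom_power (A : operator) (n : nat) : set fock :=
  if n is n'.+1 then [set psi | exists2 chi, A (psi, chi) & dom_power A n' chi]
  else setT.

Definition operator_add (A B : operator) : operator :=
  [set p | exists chi1 chi2,
     [/\ A (p.1, chi1), B (p.1, chi2) & p.2 = chi1 + chi2]].

Definition scalar_op (a : C) : operator := [set p | p.2 = a *: p.1].

Definition expi (x : R) : C := cos x +i* sin x.

Definition dispersion (m k : R) : R := Num.sqrt (k ^+ 2 + m ^+ 2).

Definition free_energy (m : R) (s : config) : R :=
  \sum_(k <- (s : seq R)) dispersion m k.

(* H_0 = \int omega(k) a*(k) a(k) dk acts on the n-particle sector as
   multiplication by omega(k_1) + ... + omega(k_n). *)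
Definition free_hamiltonian (m : R) : operator :=
  [set p | \forall s \ae mu,
     wavefun p.2 s = (free_energy m s)%:C * wavefun p.1 s].

Definition smooth_domain (m : R) : set fock :=
  \bigcap_n dom_power (free_hamiltonian m) n.

Lemma measurable_free_energy m : measurable_fun setT (free_energy m).
Proof.
have -> : [set: config] = \bigcup_n [set s : config | size s = n].
  by apply/seteqP; split => // s _; exists (size s).
apply/measurable_fun_bigcup; first by move=> n; exact: measurable_config_size.
move=> n; apply: (@eq_measurable_fun _ _ _ _ _
    (fun s : config => \sum_(i < n) dispersion m (nth 0 s i))).
  move=> s; rewrite inE /= => <-.
  by rewrite /free_energy (big_nth 0) big_mkord.
apply: measurable_funTS; apply: measurable_sum => i.
apply: (@measurableT_comp _ _ _ _ _ _ (dispersion m) _ (fun s : config => nth 0 s i)).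
  apply: measurableT_comp.
    by apply: continuous_measurable_fun; exact: sqrt_continuous.
  by apply: measurable_funD => //; exact: measurable_funX.
exact: measurable_nth.
Qed.

Lemma normc_expi x : Normc.normc (expi x) = 1.
Proof. by rewrite /= cos2Dsin2 sqrtr1. Qed.

Lemma free_evolution_subproof (m M t : R) (psi : fock) :
  (fun s => expi (t * (free_energy m s + M)) * wavefun psi s)
    \in @fockfun_pred R.
Proof.
have [fr fi fs fn] := fockfunP (wavefun psi).
have mE : measurable_fun setT (fun s : config => t * (free_energy m s + M)).
  apply: measurable_funM => //; apply: measurable_funD => //.
  exact: measurable_free_energy.
have mc : measurable_fun setT (fun s : config => cos (t * (free_energy m s + M))).
  apply: measurableT_comp => //.
  by apply: continuous_measurable_fun; exact: continuous_cos.
have ms : measurable_fun setT (fun s : config => sin (t * (free_energy m s + M))).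
  apply: measurableT_comp => //.
  by apply: continuous_measurable_fun; exact: continuous_sin.
rewrite inE; split => /=.
- rewrite (_ : (fun s => _) = (fun s =>
    cos (t * (free_energy m s + M)) * complex.Re (wavefun psi s)
    - sin (t * (free_energy m s + M)) * complex.Im (wavefun psi s))).
    by apply: measurable_funB; exact: measurable_funM.
  by apply/funext => s; case: (wavefun psi s) => [? ?].
- rewrite (_ : (fun s => _) = (fun s =>
    cos (t * (free_energy m s + M)) * complex.Im (wavefun psi s)
    + sin (t * (free_energy m s + M)) * complex.Re (wavefun psi s))).
    by apply: measurable_funD; exact: measurable_funM.
  by apply/funext => s; case: (wavefun psi s) => [? ?].
- move=> s s' ss'; congr (expi _ * _); last exact: fs.
  by rewrite /free_energy (perm_big _ ss').
- rewrite /finite_norm (_ : EFin \o _ =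
    EFin \o (fun s => Normc.normc (wavefun psi s)))//.
  apply/funext => s /=; congr EFin.
  by rewrite Normc.normcM normc_expi mul1r.
Qed.

(* exp(i (H_0 + M) t) *)
Definition free_evolution (m M t : R) (psi : fock) : fock :=
  \pi_fock (FockFun (free_evolution_subproof m M t psi)).

(* The form <phi, \prod_(i in A) a*(k_i) \prod_(i notin A) a(- k_i) psi>, that is
   <\prod_(i in A) a(k_i) phi, \prod_(i notin A) a(- k_i) psi>. For almost every
   K it does not depend on the representatives of phi and psi. *)
Definition ladder_form (n : nat) (K : config) (A : {set 'I_n}) (phi psi : fock)
    : C :=
  cintegral mu (fun s =>
    (wavefun phi ([seq nth 0 (K : seq R) i | i : 'I_n <- enum A] ++ s))^* *
    wavefun psi ([seq - nth 0 (K : seq R) i | i : 'I_n <- enum (~: A)] ++ s)).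

(* The form <phi, :phi^n(x, 0): psi>. Expanding the n-th power of
     phi(x, 0) = (4 pi)^(-1/2)
       \int e^(-ikx) [a*(k) + a(-k)] omega(k)^(-1/2) dk
   and moving the creation operators to the left yields one term for each set A
   of factors contributing a creation operator. *)
Definition wick_power (m : R) (n : nat) (x : R) (phi psi : fock) : C :=
  cintegral (lebesgue_config R n) (fun K =>
    (\prod_(k <- (K : seq R))
       (((Num.sqrt (4 * pi))^-1)%:C * expi (- (k * x))
         * ((Num.sqrt (dispersion m k))^-1)%:C))
    * \sum_(A : {set 'I_n}) ladder_form K A phi psi).

(* The form <phi, V_g(t) psi>; a point of space-time is a pair (x, t). *)
Definition interaction_form (m : R) (g : R * R -> R) (t : R) (phi psi : fock)
    : C :=
  cintegral (@lebesgue_measure R)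
    (fun x => (g (x, t))%:C * wick_power m 4 x phi psi).

(* The closure of V_g(t), where V_g(t) is defined on the intersection of the
   domains of the H_0^n: a vector chi is V_g(t) psi when it represents the form
   phi |-> <phi, V_g(t) psi> on this dense subspace. *)
Definition interaction (m : R) (g : R * R -> R) (t : R) : operator :=
  closure [set p : fock * fock | smooth_domain m p.1 /\
    forall phi, smooth_domain m phi ->
      inner phi p.2 = interaction_form m g t phi p.1].

Definition hamiltonian (m : R) (g : R * R -> R) (t : R) : operator :=
  operator_add (free_hamiltonian m) (interaction m g t).

(* H_g(t) >= - Mg for all t, with Mg > 0. The order is the one of R[i], so that
   <psi, H_g(t) psi> is in particular real. *)
Definition lower_bound (m : R) (g : R * R -> R) (Mg : R) : Prop :=
  0 < Mg /\ forall t psi chi, hamiltonian m g t (psi, chi) ->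
    - Mg%:C * inner psi psi <= inner psi chi.

(* H_g(t) + M *)
Definition shifted_hamiltonian (m : R) (g : R * R -> R) (M t : R) : operator :=
  operator_add (hamiltonian m g t) (scalar_op M%:C).

(* U t s stands for U_g(t, s) and is only constrained when s <= t. The last
   clause is i d/dt U(t, s) psi = (H_g(t) + M) U(t, s) psi, with the
   derivative taken in [s, +oo[, hence one-sided at t = s. *)
Definition is_propagator (m : R) (g : R * R -> R) (M : R)
    (U : R -> R -> fock -> fock) : Prop :=
  [/\ forall s t, s <= t -> unitary (U t s),
      forall r s t, r <= s -> s <= t -> U t s \o U s r = U t r,
      forall t, U t t = id,
      forall s t psi, s <= t -> dom (shifted_hamiltonian m g M s) psi ->
        dom (shifted_hamiltonian m g M t) (U t s psi)
    & forall s t psi, s <= t -> dom (shifted_hamiltonian m g M s) psi ->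
        exists2 chi, shifted_hamiltonian m g M t (U t s psi, chi) &
          ('i / h%:C) *: (U (t + h) s psi - U t s psi)
            @[h --> within [set h | s <= t + h] 0^'] --> chi].

(* exp(i (H_0 + M) t) U(t, s) exp(- i (H_0 + M) s) *)
Definition interaction_propagator (m M : R) (U : R -> R -> fock -> fock) (t s : R)
    (psi : fock) : fock :=
  free_evolution m M t (U t s (free_evolution m M (- s) psi)).

(* Limit t -> +oo, s -> -oo of the propagator applied to psi. *)
Definition interaction_filter (m M : R) (U : R -> R -> fock -> fock) (psi : fock)
    : set_system fock :=
  interaction_propagator m M U ts.1 ts.2 psi
    @[ts --> filter_prod (pinfty_nbhs R) (ninfty_nbhs R)].

(* S(g), as the strong (pointwise) limit; it is meaningful when the filter above
   converges for all psi. *)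
Definition bogoliubov (m M : R) (U : R -> R -> fock -> fock) (psi : fock) : fock :=
  lim (interaction_filter m M U psi).

(* C^oo: all iterated directional derivatives are differentiable. *)
Definition smooth (g : R * R -> R) : Prop :=
  forall (vs : seq (R * R)) (p : R * R),
    differentiable (foldr (fun v f q => 'D_v f q) g vs) p.

Definition supp (g : R * R -> R) : set (R * R) := closure [set p | g p != 0].

(* Nonnegative functions in C_c^oo(R^2). *)
Definition switching (g : R * R -> R) : Prop :=
  [/\ smooth g, compact (supp g) & forall p, 0 <= g p].

End Operators.

(* Main.v *)
Require Import Defs.
From HB Require Import structures.
From mathcomp Require Import all_boot all_order all_algebra.
From mathcomp Require Import all_classical all_reals all_analysis.
From mathcomp Require Import measurable_realfun complex ring lra.

(* Everything rests on the symmetry of H_g(t), which needs no estimate: the form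
   <phi, V_g(t) psi> is Hermitian whether or not the integrals defining it
   converge, because conjugation only exchanges creators and annihilators and
   k with -k, and symmetry passes to the closure. Two solutions u, v of
   i u' = H(t) u then have constant inner product, so if they start from the same
   vector and keep its norm, they agree. Before the interaction is switched on,
   the vectors of bounded energy lie in the domain; they are dense, so two
   propagators agree on [s, b] as soon as the Hamiltonians do and g vanishes at
   time s. Hence U_g^D(b, s) is the identity where g vanishes, depends only on g
   between s and b, and does not depend on the constant M. Thus S(g) = U_g^D(T, -T)
   for large T, and cutting at a time T0 between the supports, where both g1 and
   g2 vanish, factors S(g1 + g2) as U_{g1}^D(T, T0) U_{g2}^D(T0, -T). *)

Import Order.TTheory GRing.Theory Num.Theory.
Import numFieldNormedType.Exports.
Import HBNNSimple.

Set Implicit Arguments.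
Unset Strict Implicit.
Unset Printing Implicit Defensive.

Local Open Scope classical_set_scope.
Local Open Scope ring_scope.

(** * Integration under a measure-preserving involution *)

Section Involution.
Context d (T : measurableType d) (R : realType).
Variables (mu : {measure set T -> \bar R}) (phi : T -> T).
Hypotheses (mphi : measurable_fun setT phi) (phiK : involutive phi).
Hypothesis mu_phi : forall A, measurable A -> mu (phi @^-1` A) = mu A.

Let le_nnintegral_involution (f : T -> \bar R) : (forall x, 0 <= f x)%E ->
  (\int[mu]_x f x <= \int[mu]_x f (phi x))%E.
Proof.
move=> f0; rewrite [leLHS]ge0_integralTE// [leRHS]ge0_integralTE//.
apply: ge_ereal_sup => _ [h /= hf <-]; apply: ereal_sup_ubound.
pose h' := h \o phi.
have mh' : measurable_fun setT h' by apply: measurableT_comp.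
have fh' : finite_set (range h').
  by apply: sub_finite_set (fimfunP h) => _ [x _ <-]; exists (phi x).
have h'0 x : 0 <= h' x by exact: fun_ge0.
pose H1 := isMeasurableFun.Build _ _ _ _ h' mh'.
pose H2 := FiniteImage.Build _ _ h' fh'.
pose H3 := isNonNegFun.Build _ _ h' h'0.
pose hm : {nnsfun T >-> R} := HB.pack h' H1 H2 H3.
exists hm; first by move=> x; exact: hf.
apply: eq_fsbigr => r _; congr (_ * _)%E.
exact: mu_phi.
Qed.

(* No measurability of [f] is needed: the integral is a supremum over simple
   functions, and these are permuted by [phi]. *)
Lemma integral_involution (f : T -> \bar R) :
  (\int[mu]_x f (phi x) = \int[mu]_x f x)%E.
Proof.
have ge0 (g : T -> \bar R) : (forall x, 0 <= g x)%E ->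
    (\int[mu]_x g (phi x) = \int[mu]_x g x)%E.
  move=> g0; apply/eqP; rewrite eq_le le_nnintegral_involution// andbT.
  (* The reverse inequality is the first one applied to [g \o phi], as [phi] undoes itself. *)
  rewrite [leRHS](_ : _ = \int[mu]_x (g \o phi) (phi x))%E.
    by apply: le_nnintegral_involution => x /=.
  by apply: eq_integral => x _ /=; rewrite phiK.
rewrite [LHS]integralE [RHS]integralE (funepos_comp f) (funeneg_comp f).
by rewrite -(ge0 _ (funepos_ge0 f)) -(ge0 _ (funeneg_ge0 f)).
Qed.

Lemma cintegral_involution (f : T -> R[i]) :
  cintegral mu (fun x => f (phi x)) = cintegral mu f.
Proof.
rewrite /cintegral /Rintegral; congr Complex; congr fine.
  exact: (integral_involution (fun x => (complex.Re (f x))%:E)).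
exact: (integral_involution (fun x => (complex.Im (f x))%:E)).
Qed.
End Involution.

(** * Conjugation of complex integrals *)

Section Conjugation.
Local Open Scope complex_scope.

(** Negation swaps the integrals of the positive and negative parts. If either is infinite, so is
    their difference in both orders, and [fine] sends it to 0; hence no integrability is asked
    for. *)
Lemma RintegralN d (T : measurableType d) (R : realType)
    (mu : {measure set T -> \bar R}) (f : T -> R) :
  Rintegral mu setT (fun x => - f x) = - Rintegral mu setT f.
Proof.
rewrite /Rintegral [in LHS]integralE [in RHS]integralE.
have fE : (fun x => (- f x)%:E) = (\- (EFin \o f))%E by [].
rewrite [in LHS]fE funeposN funenegN.
have := @integral_ge0 _ T R mu setT _ (fun x (_ : setT x) => funepos_ge0 (EFin \o f) x).
have := @integral_ge0 _ T R mu setT _ (fun x (_ : setT x) => funeneg_ge0 (EFin \o f) x).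
case: integral => [a| |]; case: integral => [b| |] //= _ _; rewrite ?oppr0//.
by rewrite opprB.
Qed.

Lemma cintegral_conj d (T : measurableType d) (R : realType)
    (mu : {measure set T -> \bar R}) (f : T -> R[i]) :
  (cintegral mu f)^* = cintegral mu (fun x => (f x)^*).
Proof.
rewrite /cintegral /= -RintegralN; congr Complex; congr Rintegral.
  by apply/funext => x; case: (f x).
by apply/funext => x; case: (f x).
Qed.

End Conjugation.

(** * Hermitian symmetry of the Wick powers and of the interaction form *)

Section Hermitian.
Local Open Scope complex_scope.
Context (R : realType).

Definition opp_config (K : config R) : config R := map -%R (K : seq R).

Lemma opp_configK : involutive opp_config.
Proof. by move=> K; rewrite /opp_config -map_comp map_id_in// => x _ /=; rewrite opprK. Qed.

(** True out of range too, because the default value 0 is its own opposite. *)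
Lemma nth_opp_config (K : config R) i :
  nth 0 (opp_config K : seq R) i = - nth 0 (K : seq R) i.
Proof.
rewrite /opp_config; elim: (K : seq R) i => [|x s IH] [|i] //=;
by rewrite ?oppr0.
Qed.

Lemma measurable_opp_config : measurable_fun setT opp_config.
Proof.
apply: measurable_to_config => [n|i].
  rewrite (_ : [set _ | _] = [set K : config R | size K = n]).
    exact: measurable_config_size.
  by apply/seteqP; split => K /=; rewrite size_map.
under eq_fun do rewrite nth_opp_config.
apply: (measurable_funN (f := fun K : config R => nth 0 K i)).
exact: measurable_nth.
Qed.

(** Induction on n through slices of the product measure: the induction hypothesis reflects the
    tail, and the invariance of Lebesgue measure under negation reflects the first momentum. *)
Lemma lebesgue_config_opp n (A : set (config R)) : measurable A ->
  lebesgue_config R n (opp_config @^-1` A) = lebesgue_config R n A.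
Proof.
elim: n A => [|n IH] A mA //=.
have mpre (B : set (config R)) : measurable B ->
    measurable (cons_config (R:=R) @^-1` B).
  by move=> mB; rewrite -[X in measurable X]setTI; exact: measurable_cons_config.
have mxs (x : measurableTypeR R) : measurable (xsection (cons_config (R:=R) @^-1` A) x).
  by apply: measurable_xsection; exact: mpre.
rewrite /cons_measure /pushforward /product_measure1.
transitivity (\int[@lebesgue_measure R]_x
   (lebesgue_config R n (xsection (cons_config (R:=R) @^-1` A) (- x)%R)))%E.
  apply: eq_integral => x _ /=; rewrite -[RHS]IH; last exact: mxs.
  congr (lebesgue_config R n _); apply/seteqP; split => s;
  by rewrite /xsection /= !inE.
pose h x := lebesgue_config R n (xsection (cons_config (R:=R) @^-1` A) x).
have := @integral_involution _ (measurableTypeR R) R (@lebesgue_measure R)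
  (-%R : R -> R) (@oppr_measurable R setT) (@opprK R) _ h.
apply=> B mB; exact: (lebesgue_measureN mB).
Qed.

(** Conjugation exchanges the two vectors, hence the creators with the annihilators; since
    annihilators carry the momentum - k, the configuration must be reflected as well. *)
Lemma ladder_form_conj n (K : config R) (A : {set 'I_n}) (phi psi : fock R) :
  (ladder_form K A phi psi)^* = ladder_form (opp_config K) (~: A) psi phi.
Proof.
rewrite /ladder_form cintegral_conj finset.setCK; congr cintegral; apply/funext => s.
rewrite rmorphM /= conjcK mulrC.
by congr (_^* * _); congr (fockfun_val _ (_ ++ _)); apply: eq_map => i;
  rewrite nth_opp_config ?opprK.
Qed.

Lemma conjc_expi (x : R) : (expi x)^* = expi (- x).
Proof. by rewrite /expi cosN sinN. Qed.

(** The substitution K to - K undoes the conjugation of the plane waves, leaves the even function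
    omega alone and cancels the reflection in [ladder_form_conj]; summing over all A absorbs the
    passage to complements. *)
Lemma wick_power_conj m n (x : R) (phi psi : fock R) :
  (wick_power m n x phi psi)^* = wick_power m n x psi phi.
Proof.
rewrite /wick_power cintegral_conj.
rewrite -[RHS](cintegral_involution measurable_opp_config opp_configK
  (@lebesgue_config_opp n)).
congr cintegral; apply/funext => K; rewrite rmorphM; congr (_ * _).
  rewrite rmorph_prod big_map; apply: eq_bigr => k _.
  rewrite !rmorphM; congr (_ * _ * _).
  - exact: conjc_real.
  - by rewrite [LHS]conjc_expi mulNr.
  - by rewrite /dispersion sqrrN; exact: conjc_real.
rewrite raddf_sum /= (reindex_inj (inv_inj (@finset.setCK _))) /=.
by apply: eq_bigr => A _; rewrite [LHS]ladder_form_conj finset.setCK.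
Qed.

Lemma interaction_form_conj m g (t : R) (phi psi : fock R) :
  (interaction_form m g t phi psi)^* = interaction_form m g t psi phi.
Proof.
rewrite /interaction_form cintegral_conj; congr cintegral; apply/funext => x.
rewrite rmorphM; congr (_ * _); first exact: conjc_real.
exact: wick_power_conj.
Qed.
End Hermitian.

(** * Linearity and almost everywhere invariance of complex integrals *)

Section ComplexIntegral.
Context d (T : measurableType d) (R : realType).
Local Open Scope complex_scope.
Variable mu : {measure set T -> \bar R}.
Implicit Types f g : T -> R[i].

Definition cintegrable f :=
  mu.-integrable setT (EFin \o (fun x => complex.Re (f x))) /\
  mu.-integrable setT (EFin \o (fun x => complex.Im (f x))).

Lemma cintegral_lin a f g : cintegrable f -> cintegrable g ->
  cintegral mu (fun x => a * f x + g x) = a * cintegral mu f + cintegral mu g.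
Proof.
move=> [fr fi] [gr gi].
have iZ (c : R) (h : T -> R) : mu.-integrable setT (EFin \o h) ->
    mu.-integrable setT (EFin \o (fun x => c * h x)).
  by move=> ih; exact: (integrableZl _ c ih).
rewrite /cintegral.
have -> : (fun x => complex.Re (a * f x + g x)) =
    (fun x => (complex.Re a * complex.Re (f x) - complex.Im a * complex.Im (f x))
       + complex.Re (g x)).
  by apply/funext => x; case: (a) (f x) (g x) => [? ?] [? ?] [? ?].
have -> : (fun x => complex.Im (a * f x + g x)) =
    (fun x => (complex.Re a * complex.Im (f x) + complex.Im a * complex.Re (f x))
       + complex.Im (g x)).
  by apply/funext => x; case: (a) (f x) (g x) => [? ?] [? ?] [? ?].
rewrite RintegralD//; last first.
  exact: (integrableB _ (iZ _ _ fr) (iZ _ _ fi)).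
rewrite RintegralB//; [|exact: iZ..].
rewrite RintegralD//; last first.
  exact: (integrableD _ (iZ _ _ fi) (iZ _ _ fr)).
rewrite RintegralD//; [|exact: iZ..].
by rewrite !RintegralZl//; case: (a) => ? ?.
Qed.

Lemma eq_ae_Rintegral (f g : T -> R) :
  measurable_fun setT f -> measurable_fun setT g ->
  (\forall x \ae mu, f x = g x) -> Rintegral mu setT f = Rintegral mu setT g.
Proof.
move=> mf mg fg; rewrite /Rintegral; congr fine; apply: ae_eq_integral => //.
- exact/measurable_EFinP.
- exact/measurable_EFinP.
- by apply: filterS fg => x /= ->.
Qed.

Lemma eq_ae_cintegral f g :
  measurable_fun setT (fun x => complex.Re (f x)) ->
  measurable_fun setT (fun x => complex.Im (f x)) ->
  measurable_fun setT (fun x => complex.Re (g x)) ->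
  measurable_fun setT (fun x => complex.Im (g x)) ->
  (\forall x \ae mu, f x = g x) -> cintegral mu f = cintegral mu g.
Proof.
move=> fr fi gr gi fg; rewrite /cintegral.
by congr Complex; apply: eq_ae_Rintegral => //; apply: filterS fg => x ->.
Qed.
End ComplexIntegral.

(** * The inner product and the norm of Fock space *)

Section Inner.
Context (R : realType).
Local Open Scope complex_scope.
Local Open Scope quotient_scope.
Local Notation C := R[i].
Local Notation fock := (fock R).
Local Notation mu := (fock_measure R).
Local Notation normc := (@Normc.normc R).
Implicit Types (f g : fockfun R) (x y z : fock) (a : C).

Lemma fockfun_Lfun f : (fun s => normc (f s)) \in Lfun mu 2%:E.
Proof.
have [fr fi _ fn] := fockfunP f.
by apply/andP; rewrite !inE; split => //; exact: measurable_normc.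
Qed.

Lemma integrable_normc2 f :
  mu.-integrable setT (EFin \o (fun s => normc (f s) ^+ 2)).
Proof. exact: Lfun2_integrable_sqr (fockfun_Lfun f). Qed.

Lemma ler_Re_normc (c : C) : `|complex.Re c| <= normc c.
Proof. by case: c => u v /=; rewrite -sqrtr_sqr ler_wsqrtr// lerDl sqr_ge0. Qed.

Lemma ler_Im_normc (c : C) : `|complex.Im c| <= normc c.
Proof. by case: c => u v /=; rewrite -sqrtr_sqr ler_wsqrtr// lerDr sqr_ge0. Qed.

(** The modulus of the product is at most |f|^2 + |g|^2, which is integrable. *)
Lemma cintegrable_pairing f g : cintegrable mu (fun s => (f s)^* * g s).
Proof.
have [fr fi _ _] := fockfunP f; have [gr gi _ _] := fockfunP g.
have le (s : config R) :
    normc ((f s)^* * g s) <= normc (f s) ^+ 2 + normc (g s) ^+ 2.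
  rewrite Normc.normcM (_ : normc (f s)^* = normc (f s)); last first.
    by case: (f s) => u v /=; rewrite sqrrN.
  have := sqr_ge0 (normc (f s) - normc (g s)).
  have : 0 <= normc (f s) * normc (g s) by rewrite mulr_ge0 ?normc_ge0.
  nra.
have iN : mu.-integrable setT
    (EFin \o (fun s => normc (f s) ^+ 2 + normc (g s) ^+ 2)).
  exact: (integrableD _ (integrable_normc2 f) (integrable_normc2 g)).
split; apply: le_integrable iN => //.
- apply/measurable_EFinP; rewrite (_ : (fun s => _) = (fun s =>
    complex.Re (f s) * complex.Re (g s) + complex.Im (f s) * complex.Im (g s))).
    by apply: measurable_funD; exact: measurable_funM.
  by apply/funext => s; case: (f s) (g s) => ? ? [? ?] /=; rewrite mulNr opprK.
- move=> s _; rewrite /= lee_fin [leRHS]ger0_norm ?addr_ge0 ?sqr_ge0//.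
  by apply: le_trans (ler_Re_normc _) (le s).
- apply/measurable_EFinP; rewrite (_ : (fun s => _) = (fun s =>
    complex.Re (f s) * complex.Im (g s) - complex.Im (f s) * complex.Re (g s))).
    by apply: measurable_funB; exact: measurable_funM.
  by apply/funext => s; case: (f s) (g s) => ? ? [? ?] /=; rewrite mulNr.
- move=> s _; rewrite /= lee_fin [leRHS]ger0_norm ?addr_ge0 ?sqr_ge0//.
  by apply: le_trans (ler_Im_normc _) (le s).
Qed.

Lemma cintegrable_measurable (h : config R -> C) : cintegrable mu h ->
  measurable_fun setT (fun s => complex.Re (h s)) /\
  measurable_fun setT (fun s => complex.Im (h s)).
Proof.
by case=> /integrableP[/measurable_EFinP ? _] /integrableP[/measurable_EFinP ? _].
Qed.

Lemma inner_ae x y f g :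
  (\forall s \ae mu, wavefun x s = f s) -> (\forall s \ae mu, wavefun y s = g s) ->
  inner x y = cintegral mu (fun s => (f s)^* * g s).
Proof.
move=> xf yg.
have [? ?] := cintegrable_measurable (cintegrable_pairing (wavefun x) (wavefun y)).
have [? ?] := cintegrable_measurable (cintegrable_pairing f g).
rewrite /inner; apply: eq_ae_cintegral => //.
by apply: filterS2 xf yg => s -> ->.
Qed.

Lemma wavefun_lin a x y :
  \forall s \ae mu, wavefun (a *: x + y) s = (a *: wavefun x + wavefun y : fockfun R) s.
Proof.
have -> : a *: x + y = \pi_fock (a *: wavefun x + wavefun y).
  by rewrite pi_fockD [\pi_fock (a *: _)]pi_fockZ /wavefun !reprK.
exact: wavefunK.
Qed.

Lemma inner_lin x a y z : inner x (a *: y + z) = a * inner x y + inner x z.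
Proof.
rewrite (@inner_ae _ _ (wavefun x) (a *: wavefun y + wavefun z)); last 2 first.
- exact: nearW.
- exact: wavefun_lin.
rewrite -cintegral_lin; [|exact: cintegrable_pairing..].
by congr cintegral; apply/funext => s; rewrite mulrDr mulrCA.
Qed.

Lemma conj_inner x y : (inner x y)^* = inner y x.
Proof.
rewrite /inner cintegral_conj; congr cintegral; apply/funext => s.
by rewrite rmorphM [X in X * _]conjcK mulrC.
Qed.

Lemma innerDr x y z : inner x (y + z) = inner x y + inner x z.
Proof. by have := inner_lin x 1 y z; rewrite scale1r mul1r. Qed.

Lemma inner0r x : inner x 0 = 0.
Proof. by apply: (addrI (inner x 0)); rewrite -innerDr !addr0. Qed.

Lemma innerZr x a y : inner x (a *: y) = a * inner x y.
Proof. by have := inner_lin x a y 0; rewrite inner0r !addr0. Qed.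

Lemma innerDl x y z : inner (x + y) z = inner x z + inner y z.
Proof. by rewrite -conj_inner innerDr rmorphD; congr (_ + _); exact: conj_inner. Qed.

Lemma innerZl x a y : inner (a *: x) y = conjc a * inner x y.
Proof. by rewrite -conj_inner innerZr rmorphM; congr (_ * _); exact: conj_inner. Qed.

Lemma innerNr x y : inner x (- y) = - inner x y.
Proof. by rewrite -scaleN1r innerZr mulN1r. Qed.

(** The norm of [fock] takes values in [R[i]]; limits and inequalities are handled on this
    underlying real number. *)
Definition rnorm x : R := fine ('N[mu]_2%:E[EFin \o (fun s => normc (wavefun x s))])%E.

Lemma normE x : `|x| = (rnorm x)%:C. Proof. by []. Qed.

Lemma rnorm_ge0 x : 0 <= rnorm x.
Proof. by rewrite -ler0c -normE. Qed.

Lemma rnorm_sqr x :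
  rnorm x ^+ 2 = Rintegral mu setT (fun s => normc (wavefun x s) ^+ 2).
Proof.
have two_neq0 : (2 : R) != 0 by rewrite pnatr_eq0.
have := powR_Lnorm mu (EFin \o (fun s => normc (wavefun x s))) two_neq0.
rewrite -[in LHS](fineK (N2fin (wavefun x))) poweR_EFin powR_mulrn ?rnorm_ge0//.
rewrite /Rintegral => /(congr1 fine) /= ->; congr fine; apply: eq_integral => s _.
by rewrite /= powR_mulrn// ger0_norm ?normc_ge0.
Qed.

Lemma Re_inner_self x : complex.Re (inner x x) = rnorm x ^+ 2.
Proof.
rewrite rnorm_sqr /inner /cintegral /=; congr Rintegral; apply/funext => s.
case: (wavefun x s) => u v /=; rewrite sqr_sqrtr ?addr_ge0 ?sqr_ge0//.
by rewrite mulNr opprK !expr2.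
Qed.
End Inner.

(** * Functions with vanishing forward derivative *)

Section OneSidedDerivative.
Context (R : realType).

(** The filter of the derivative clause in [is_propagator]: one-sided at t = s, two-sided at later
    times. *)
Definition forward_increments (s t : R) : set_system R :=
  within [set h | s <= t + h] 0^'.

Global Instance forward_increments_filter s t : Filter (forward_increments s t).
Proof. exact: within_filter. Qed.

Lemma forward_increments_neq0 s t : \forall h \near forward_increments s t, h != 0.
Proof. by apply: (@filterE R (nbhs (0 : R))) => h. Qed.

Lemma cvg_forward_increments (s t : R) :
  h @[h --> forward_increments s t] --> (0 : R).
Proof.
by apply: cvg_within_filter; apply: cvg_within_filter; exact: cvg_id.
Qed.

Lemma cvg_dnbhs_forward_increments (s t : R) (f : R -> R) (l : R) : s < t ->
  f h @[h --> forward_increments s t] --> l -> f h @[h --> 0^'] --> l.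
Proof.
move=> st fl A /fl fA.
have st' : nbhs (0 : R) [set h | s <= t + h].
  exists (t - s) => /=; first by rewrite subr_gt0.
  move=> h /=; rewrite sub0r normrN => /ltW; rewrite ler_norml; lra.
have {}fA : nbhs (0 : R) [set h | h != 0 -> s <= t + h -> A (f h)] := fA.
change (nbhs (0 : R) [set h | h != 0 -> A (f h)]).
by move: fA st'; apply: filterS2 => h /= + sth h0; apply.
Qed.

(** Mean value theorem on [s, b]: for t > s the limit is an ordinary derivative, and at s it still
    gives continuity from the right. *)
Lemma zero_forward_derivative (s b : R) (G : R -> R) : s <= b ->
  (forall t, s <= t <= b ->
     h^-1 * (G (t + h) - G t) @[h --> forward_increments s t] --> 0) ->
  G b = G s.
Proof.
rewrite le_eqVlt => /predU1P[->//|sb] dG.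
have cG t : s <= t <= b -> G (t + h) @[h --> forward_increments s t] --> G t.
  move=> /dG dGt.
  (* An increment of [G] is h times its difference quotient, so it tends to 0. *)
  have : h * (h^-1 * (G (t + h) - G t)) + G t @[h --> forward_increments s t]
      --> 0 * 0 + G t.
    by apply: cvgD; [apply: cvgM dGt; exact: cvg_forward_increments|exact: cvg_cst].
  rewrite mul0r add0r; apply: cvg_trans; apply: near_eq_cvg.
  apply: filterS (forward_increments_neq0 s t) => h h0.
  by rewrite mulrA divff// mul1r subrK.
have dG' t : s < t <= b -> is_derive t 1 G 0.
  move=> /andP[st tb].
  have key : h^-1 *: ((G \o shift t) (h *: 1) - G t) @[h --> 0^'] --> 0.
    have -> : (fun h => h^-1 *: ((G \o shift t) (h *: 1) - G t)) =
        (fun h => h^-1 * (G (t + h) - G t)).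
      apply/funext => h; congr (_ * (G _ - _)); rewrite /= addrC.
      by congr (_ + _); exact: mulr1.
    apply: (cvg_dnbhs_forward_increments st); apply: dG.
    by rewrite tb andbT; exact: ltW.
  by apply: DeriveDef; [apply/cvg_ex; exists 0|exact: cvg_lim].
have ctG t : s < t <= b -> {for t, continuous G}.
  move=> /dG'[dGt _]; exact/differentiable_continuous/derivable1_diffP.
have [| |c _] := @MVT R G (fun=> 0) s b sb.
- by move=> x; rewrite in_itv/= => /andP[sx xb]; apply: dG'; rewrite sx ltW.
- apply/continuous_within_itvP => //; split.
  + by move=> x; rewrite in_itv/= => /andP[sx xb]; apply: ctG; rewrite sx ltW.
  (* At s only continuity from the right is available; x - s, for x tending to s from the right, is
     a forward increment. *)
  + have sub0 : x - s @[x --> s^'+] `=>` forward_increments s s.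
      move=> A sA.
      have {}sA : nbhs (0 : R) [set h | h != 0 -> s <= s + h -> A h] := sA.
      change (nbhs s [set x | s < x -> A (x - s)]).
      have : x - s @[x --> s] --> s - s by apply: cvgB; [exact: cvg_id|exact: cvg_cst].
      rewrite subrr => /(_ _ sA) hA.
      have {hA} : nbhs s [set x | x - s != 0 -> s <= s + (x - s) -> A (x - s)] := hA.
      apply: filterS => x /= + sx; apply.
        by rewrite subr_eq0 gt_eqF.
      by rewrite subrKC ltW.
    have cGs : G (s + h) @[h --> forward_increments s s] --> G s.
      by apply: cG; rewrite lexx ltW.
    have -> : G = (fun x => G (s + (x - s))) by apply/funext => x; rewrite subrKC.
    by rewrite subrr addr0 => A /cGs /sub0.
  + by apply: cvg_at_left_filter; apply: ctG; rewrite sb lexx.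
by rewrite mul0r => /eqP; rewrite subr_eq0 => /eqP.
Qed.
End OneSidedDerivative.

(** * The real part of the inner product, and convergence in norm *)

Section RealInner.
Context (R : realType).
Local Open Scope complex_scope.
Local Notation C := R[i].
Local Notation fock := (fock R).
Implicit Types (x y z : fock) (a : C).

Definition rinner x y : R := complex.Re (inner x y).

Lemma rinnerC x y : rinner x y = rinner y x.
Proof. by rewrite /rinner -conj_inner; case: (inner y x). Qed.

Lemma rinnerDr x y z : rinner x (y + z) = rinner x y + rinner x z.
Proof. by rewrite /rinner innerDr; case: (inner x y) (inner x z) => ? ? []. Qed.

Lemma rinnerNr x y : rinner x (- y) = - rinner x y.
Proof. by rewrite /rinner innerNr; case: (inner x y). Qed.

Lemma rinnerDl x y z : rinner (x + y) z = rinner x z + rinner y z.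
Proof. by rewrite rinnerC rinnerDr !(rinnerC z). Qed.

Lemma rinnerNl x y : rinner (- x) y = - rinner x y.
Proof. by rewrite rinnerC rinnerNr rinnerC. Qed.

Lemma rinnerZr (c : R) x y : rinner x (c%:C *: y) = c * rinner x y.
Proof. by rewrite /rinner innerZr; case: (inner x y) => ? ? /=; rewrite mul0r subr0. Qed.

Lemma rinnerZl (c : R) x y : rinner (c%:C *: x) y = c * rinner x y.
Proof. by rewrite rinnerC rinnerZr rinnerC. Qed.

Lemma rinner_self x : rinner x x = rnorm x ^+ 2.
Proof. exact: Re_inner_self. Qed.

(** Since Im z = Re (- i z), identities and limits for [inner] reduce to [rinner]. *)
Lemma Im_inner x y : complex.Im (inner x y) = rinner x (- 'i *: y).
Proof.
rewrite /rinner innerZr; case: (inner x y) => u v /=.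
by rewrite oppr0 mul0r sub0r mulN1r opprK.
Qed.

Lemma rinner_polarization x y :
  rinner x y = (rnorm (x + y) ^+ 2 - rnorm (x - y) ^+ 2) / 4.
Proof.
rewrite -!rinner_self !(rinnerDr, rinnerDl, rinnerNr, rinnerNl) (rinnerC y x).
by field.
Qed.

Lemma rnormZ a x : rnorm (a *: x) = Normc.normc a * rnorm x.
Proof. by have := normrZ a x; rewrite !normE => -[]; rewrite mul0r subr0. Qed.

Lemma ler_rnormD x y : rnorm (x + y) <= rnorm x + rnorm y.
Proof. by have := ler_normD x y; rewrite !normE -rmorphD lecR. Qed.

Lemma rnormN x : rnorm (- x) = rnorm x.
Proof. by have := normrN x; rewrite !normE => /complexI. Qed.

Lemma rnorm_eq0 x : rnorm x = 0 -> x = 0.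
Proof. by move=> x0; apply/normr0_eq0; rewrite normE x0. Qed.

Lemma inner_preserving_rnorm (A : fock -> fock) :
  (forall x y, inner (A x) (A y) = inner x y) -> forall x, rnorm (A x) = rnorm x.
Proof.
move=> hA x; apply/eqP; rewrite -(@eqrXn2 _ 2) ?rnorm_ge0//.
by rewrite -!rinner_self /rinner hA.
Qed.

(** Expanding |x - y|^2 gives 0. This turns the conservation of inner products into the equality of
    two solutions. *)
Lemma eq_of_rinner x y :
  rnorm x = rnorm y -> rinner x y = rnorm x ^+ 2 -> x = y.
Proof.
move=> xy ixy; apply/subr0_eq/rnorm_eq0/eqP.
rewrite -sqrf_eq0 -rinner_self.
rewrite !(rinnerDr, rinnerDl, rinnerNr, rinnerNl) (rinnerC y x) !rinner_self ixy xy.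
by apply/eqP; ring.
Qed.

Section Convergence.
Context (T : Type) (F : set_system T) {FF : Filter F}.
Implicit Types (f g : T -> fock).

Lemma cvg_rdist f x :
  f @ F --> x <-> forall e : R, 0 < e -> \forall t \near F, rnorm (x - f t) < e.
Proof.
split=> [/cvgrPdist_lt fx e e0|fx].
  have /fx : 0 < e%:C by rewrite ltcR.
  by apply: filterS => t; rewrite normE ltcR.
(* A positive element of [R[i]] has imaginary part 0. *)
apply/cvgrPdist_lt => -[e e']; rewrite ltcE /= => /andP[/eqP -> e0].
by apply: filterS (fx _ e0) => t; rewrite normE ltcR.
Qed.

Lemma cvg_rdist_bound f x (r : T -> R) :
  (\forall t \near F, rnorm (x - f t) <= r t) -> r @ F --> 0 -> f @ F --> x.
Proof.
move=> fr /cvgr0Pnorm_lt r0; apply/cvg_rdist => e e0.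
apply: filterS2 fr (r0 _ e0) => t h; apply: le_lt_trans.
by apply: le_trans h _; exact: ler_norm.
Qed.

Lemma cvg_rnorm f x : f @ F --> x -> rnorm (f t) @[t --> F] --> rnorm x.
Proof.
move=> /cvg_rdist fx; apply/cvgrPdist_lt => e /fx; apply: filterS => t.
apply: le_lt_trans; rewrite ler_norml.
have := ler_rnormD (x - f t) (f t); rewrite subrK.
have := ler_rnormD (f t - x) x; rewrite subrK -[rnorm (f t - x)]rnormN opprB.
by lra.
Qed.

(** Polarization reduces this to the continuity of the norm, without the Cauchy-Schwarz
    inequality. *)
Lemma cvg_rinner f g x y : f @ F --> x -> g @ F --> y ->
  rinner (f t) (g t) @[t --> F] --> rinner x y.
Proof.
move=> fx gy; under eq_fun do rewrite rinner_polarization.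
rewrite rinner_polarization; apply: cvgM; last exact: cvg_cst.
apply: cvgB; rewrite expr2; under eq_fun do rewrite expr2.
  by apply: cvgM; apply: cvg_rnorm; exact: cvgD.
by apply: cvgM; apply: cvg_rnorm; exact: cvgB.
Qed.

(** Convergence of the scalars is given by a real bound on the modulus, the form in which the phase
    estimates below provide it. *)
Lemma cvg_rdistZ (s : T -> C) (k : C) (r : T -> R) f x :
  (\forall t \near F, Normc.normc (k - s t) <= r t) -> r @ F --> 0 ->
  f @ F --> x -> s t *: f t @[t --> F] --> k *: x.
Proof.
move=> sr r0 fx.
apply: (@cvg_rdist_bound _ _ (fun t =>
  Normc.normc k * rnorm (x - f t) + r t * rnorm (f t))).
  apply: filterS sr => t kr.
  have -> : k *: x - s t *: f t = k *: (x - f t) + (k - s t) *: f t.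
    by rewrite scalerBr scalerBl addrA subrK.
  apply: le_trans (ler_rnormD _ _) _; rewrite !rnormZ lerD2l.
  by rewrite ler_wpM2r// rnorm_ge0.
have -> : 0 = Normc.normc k * 0 + 0 * rnorm x by rewrite mulr0 mul0r addr0.
apply: cvgD; apply: cvgM => //; last exact: cvg_rnorm.
  exact: cvg_cst.
apply/cvgrPdist_lt => e e0; have /cvg_rdist/(_ _ e0) := fx.
by apply: filterS => t; rewrite sub0r normrN ger0_norm// rnorm_ge0.
Qed.
End Convergence.
End RealInner.

(** * Quantitative derivatives of phases *)

Section PhaseEstimates.
Context (R : realType).
Local Open Scope complex_scope.
Local Notation C := R[i].
Local Notation normc := (@Normc.normc R).

Lemma expiD (x y : R) : expi (x + y) = expi x * expi y.
Proof.
rewrite /expi cosD sinD; apply/eqP; rewrite eq_complex /=.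
by rewrite eqxx /= [X in X == _]addrC eqxx.
Qed.

Lemma expi0 : expi (0 : R) = 1.
Proof. by rewrite /expi cos0 sin0. Qed.

Lemma normc_Re_Im (z : C) :
  normc z <= `|complex.Re z| + `|complex.Im z|.
Proof.
case: z => u v /=; rewrite -[leRHS]ger0_norm ?addr_ge0// -sqrtr_sqr ler_wsqrtr//.
rewrite sqrrD !real_normK ?num_real//.
have : 0 <= `|u| * `|v| by rewrite mulr_ge0.
by rewrite mulr2n; lra.
Qed.

Lemma ler_norm_sin (x : R) : `|sin x| <= `|x|.
Proof.
wlog x0 : x / 0 <= x => [hw|].
  have [|x0] := leP 0 x; first exact: hw.
  by rewrite -normrN -sinN -[leRHS]normrN hw// oppr_ge0 ltW.
have [|c _] := @MVT_segment R sin cos 0 x x0.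
  by apply: continuous_subspaceT => y; exact: continuous_sin.
rewrite sin0 !subr0 => ->; rewrite normrM ler_piMl// ler_norml.
by rewrite cos_geN1 cos_le1.
Qed.

Lemma ler_norm_cosB1 (x : R) : `|cos x - 1| <= `|x| /\ `|cos x - 1| <= x ^+ 2.
Proof.
wlog x0 : x / 0 <= x => [hw|].
  have [|x0] := leP 0 x; first exact: hw.
  by rewrite -cosN -sqrrN -[`|x|]normrN; apply: hw; rewrite oppr_ge0 ltW.
have [|c] := @MVT_segment R cos (fun y => - sin y) 0 x x0.
  by apply: continuous_subspaceT => y; exact: continuous_cos.
rewrite in_itv/= => /andP[c0 cx].
rewrite cos0 !subr0 => ->; rewrite normrM normrN (ger0_norm x0); split.
  by rewrite ler_piMl// ler_norml sin_geN1 sin_le1.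
rewrite expr2 ler_wpM2r//; apply: le_trans (ler_norm_sin _) _.
by rewrite ger0_norm.
Qed.

Lemma ler_norm_sinB (x : R) : `|sin x - x| <= x ^+ 2.
Proof.
wlog x0 : x / 0 <= x => [hw|].
  have [|x0] := leP 0 x; first exact: hw.
  have -> : sin x - x = - (sin (- x) - - x) by rewrite sinN; ring.
  by rewrite normrN -sqrrN; apply: hw; rewrite oppr_ge0 ltW.
have [|c] := @MVT_segment R (fun y => sin y - y) (fun y => cos y - 1) 0 x x0.
  apply: continuous_subspaceT => y; apply: cvgB; [exact: continuous_sin|exact: cvg_id].
rewrite in_itv/= => /andP[c0 cx].
rewrite sin0 !subr0 => ->; rewrite normrM expr2 (ger0_norm x0) ler_wpM2r//.
by apply: le_trans (ler_norm_cosB1 c).1 _; rewrite ger0_norm.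
Qed.

(** The real part cos x - 1 and the imaginary part sin x - x each contribute x^2, whence the factor
    2. *)
Lemma expi_taylor (x : R) : normc (expi x - 1 - 'i * x%:C) <= 2 * x ^+ 2.
Proof.
apply: le_trans (normc_Re_Im _) _; rewrite mulr2n mulrDl mul1r.
have -> : complex.Re (expi x - 1 - 'i * x%:C) = cos x - 1.
  by rewrite /= mul0r mul1r subrr subr0.
have -> : complex.Im (expi x - 1 - 'i * x%:C) = sin x - x.
  by rewrite /= mul0r mul1r add0r oppr0 addr0.
by rewrite lerD ?ler_norm_sinB//; exact: (ler_norm_cosB1 x).2.
Qed.

(** At time 0, i d/dt sends the phase [expi (a * t)] to - a. The error is the Taylor remainder at a
    h divided by |h|; its explicit dependence on a makes it uniform over bounded energies in
    [schrodinger_free]. *)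
Lemma expi_quotient (a h : R) : h != 0 ->
  normc (- a%:C - ('i / h%:C) * (expi (a * h) - 1)) <= 2 * a ^+ 2 * `|h|.
Proof.
move=> h0; have hC0 : h%:C != 0 by rewrite eq_complex /= eqxx andbT.
have qE : 'i / h%:C * ('i * (a * h)%:C) = - a%:C.
  rewrite rmorphM mulrACA -expr2 sqr_i mulN1r; congr (- _).
  by rewrite mulrCA mulVf// mulr1.
have -> : - a%:C - ('i / h%:C) * (expi (a * h) - 1) =
    - ('i / h%:C * (expi (a * h) - 1 - 'i * (a * h)%:C)).
  by rewrite [in RHS]mulrBr qE opprK opprD addrC.
have nr (c : R) : normc c%:C = `|c| by rewrite /= expr0n addr0 sqrtr_sqr.
have ni : normc ('i : C) = 1 by rewrite /= expr0n add0r expr1n sqrtr1.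
rewrite normcN !Normc.normcM Normc.normcV nr ni mul1r.
rewrite ler_pdivrMl ?normr_gt0//; apply: le_trans (expi_taylor _) _.
rewrite exprMn -[h ^+ 2]real_normK ?num_real//.
by rewrite le_eqVlt; apply/orP; left; apply/eqP; ring.
Qed.
End PhaseEstimates.

(** * Schrodinger equations and symmetric operators *)

Section Schrodinger.
Context (R : realType).
Local Open Scope complex_scope.
Local Notation C := R[i].
Local Notation fock := (fock R).
Local Notation operator := (operator R).
Implicit Types (x y z : fock) (a : C).

Definition schrodinger (s : R) (u : R -> fock) (t : R) (chi : fock) : Prop :=
  ('i / h%:C) *: (u (t + h) - u t) @[h --> forward_increments s t] --> chi.

Lemma schrodinger_derivative s u t chi : schrodinger s u t chi ->
  (h^-1)%:C *: (u (t + h) - u t) @[h --> forward_increments s t] --> - 'i *: chi.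
Proof.
move=> du.
have -> : (fun h => (h^-1)%:C *: (u (t + h) - u t)) =
    (fun h => - 'i *: (('i / h%:C) *: (u (t + h) - u t))).
  apply/funext => h; rewrite scalerA mulNr mulrA -expr2 sqr_i mulN1r opprK.
  by rewrite fmorphV.
apply: cvg_rdistZ du; last exact: cvg_cst.
by apply: nearW => h; rewrite subrr Normc.normc0.
Qed.

Lemma cvg_norm_increment s t (c : R) :
  c * `|h| @[h --> forward_increments s t] --> 0.
Proof.
rewrite -[X in _ --> X](mulr0 c) -(normr0 R); apply: cvgM; first exact: cvg_cst.
by apply: cvg_norm; exact: cvg_forward_increments.
Qed.

Lemma schrodinger_continuous s u t chi : schrodinger s u t chi ->
  u (t + h) @[h --> forward_increments s t] --> u t.
Proof.
move=> /schrodinger_derivative du.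
have : h%:C *: ((h^-1)%:C *: (u (t + h) - u t)) + u t
    @[h --> forward_increments s t] --> 0 *: (- 'i *: chi) + u t.
  apply: cvgD; last exact: cvg_cst.
  apply: cvg_rdistZ (cvg_norm_increment s t 1) du.
  apply: nearW => h; rewrite sub0r normcN mul1r.
  by rewrite /= expr0n addr0 sqrtr_sqr.
rewrite scale0r add0r; apply: cvg_trans; apply: near_eq_cvg.
apply: filterS (forward_increments_neq0 s t) => h h0.
by rewrite scalerA -rmorphM divff// scale1r subrK.
Qed.

(** Product rule: differentiating the phase contributes - a u. With a = M it removes the constant M
    from the Hamiltonian. *)
Lemma schrodinger_phase s u t chi (a : R) : schrodinger s u t chi ->
  schrodinger s (fun r => expi (a * (r - s)) *: u r) t
    (expi (a * (t - s)) *: (chi - a%:C *: u t)).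
Proof.
move=> du; rewrite /schrodinger scalerBr scalerA -scaleNr -mulrN.
set e := expi (a * (t - s)).
have eh h : expi (a * (t + h - s)) = e * expi (a * h).
  by rewrite -expiD -mulrDr addrAC.
(* Discrete product rule: the quotient of u times the phase at t + h, plus the quotient of the phase
   times u at t. *)
have -> : (fun h => ('i / h%:C) *: (expi (a * (t + h - s)) *: u (t + h) - e *: u t)) =
    (fun h => (e * expi (a * h)) *: (('i / h%:C) *: (u (t + h) - u t)) +
      (e * (('i / h%:C) * (expi (a * h) - 1))) *: u t).
  apply/funext => h; rewrite eh !scalerA [e * ('i / _ * _)]mulrCA -[('i / _ * _) *: u t]scalerA.
  rewrite [_ * _ * ('i / _)]mulrC -[('i / _ * _) *: _]scalerA -scalerDr; congr (_ *: _).
  by rewrite mulrBr mulr1 scalerBl scalerBr addrA subrK.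
have ne : Normc.normc e = 1 by exact: normc_expi.
apply: cvgD.
  apply: cvg_rdistZ (cvg_norm_increment s t (2 * `|a|)) du.
  apply: nearW => h; rewrite -[X in X - _]mulr1 -mulrBr Normc.normcM ne mul1r.
  apply: le_trans (normc_Re_Im _) _.
  have -> : complex.Re (1 - expi (a * h)) = - (cos (a * h) - 1) by rewrite /= opprB.
  have -> : complex.Im (1 - expi (a * h)) = - sin (a * h) by rewrite /= sub0r.
  rewrite !normrN -mulrA -normrM mulr2n mulrDl mul1r lerD ?ler_norm_sin//.
  exact: (ler_norm_cosB1 _).1.
apply: cvg_rdistZ (cvg_norm_increment s t (2 * a ^+ 2)) (cvg_cst _).
apply: filterS (forward_increments_neq0 s t) => h h0.
by rewrite -mulrBr Normc.normcM ne mul1r; exact: expi_quotient.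
Qed.

Definition symmetric_op (A : operator) : Prop :=
  forall p q, A p -> A q -> inner p.1 q.2 = inner p.2 q.1.

(** The derivative of Re <u, v> is Im <u, A v> + Im <v, A u>, and by symmetry of A the two inner
    products are conjugate. *)
Lemma rinner_conserved s b (u v : R -> fock) (A : R -> operator) : s <= b ->
  (forall t, symmetric_op (A t)) ->
  (forall t, s <= t <= b -> exists2 chi, A t (u t, chi) & schrodinger s u t chi) ->
  (forall t, s <= t <= b -> exists2 chi, A t (v t, chi) & schrodinger s v t chi) ->
  rinner (u b) (v b) = rinner (u s) (v s).
Proof.
move=> sb symA du dv.
apply: (@zero_forward_derivative _ _ _ (fun t => rinner (u t) (v t)) sb) => t stb.
have [chi Achi {}du] := du _ stb; have [xi Axi {}dv] := dv _ stb.
(* The first term keeps u at t + h, so its limit uses the continuity of u. *)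
have -> : (fun h => h^-1 * (rinner (u (t + h)) (v (t + h)) - rinner (u t) (v t))) =
    (fun h => rinner (u (t + h)) ((h^-1)%:C *: (v (t + h) - v t))
      + rinner ((h^-1)%:C *: (u (t + h) - u t)) (v t)).
  apply/funext => h; rewrite rinnerZl rinnerZr -mulrDr; congr (_ * _).
  by rewrite rinnerDr rinnerDl rinnerNr rinnerNl; ring.
have -> : 0 = rinner (u t) (- 'i *: xi) + rinner (- 'i *: chi) (v t).
  rewrite [X in _ + X]rinnerC -!Im_inner.
  have -> : inner (u t) xi = inner chi (v t) := symA _ _ _ Achi Axi.
  rewrite -conj_inner.
  by case: (inner (v t) chi) => p q /=; rewrite addrC subrr.
apply: cvgD; apply: cvg_rinner.
- exact: schrodinger_continuous du.
- exact: schrodinger_derivative.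
- exact: schrodinger_derivative.
- exact: cvg_cst.
Qed.

(* Absorbs the phases expi (M * (t - s)). That the graph of the interaction is
   itself closed under scalars is not clear without estimates on the integrals
   defining its form. *)
Definition scalar_hull (A : operator) : operator :=
  [set p | exists a q, A q /\ p = (a *: q.1, a *: q.2)].

Lemma symmetric_scalar_hull A : symmetric_op A -> symmetric_op (scalar_hull A).
Proof.
move=> symA _ _ [a [p [Ap ->]]] [b [q [Aq ->]]] /=.
by rewrite !innerZl !innerZr symA.
Qed.

Lemma symmetric_operator_add A B :
  symmetric_op A -> symmetric_op B -> symmetric_op (operator_add A B).
Proof.
move=> symA symB [p p'] [q q'] /= [p1 [p2 [Ap Bp /= ->]]] [q1 [q2 [Aq Bq /= ->]]].
by rewrite innerDr innerDl (symA _ _ Ap Aq) (symB _ _ Bp Bq).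
Qed.

Lemma symmetric_free_hamiltonian (m : R) : symmetric_op (free_hamiltonian m).
Proof.
move=> p q Hp Hq.
have [? ?] := cintegrable_measurable (cintegrable_pairing (wavefun p.1) (wavefun q.2)).
have [? ?] := cintegrable_measurable (cintegrable_pairing (wavefun p.2) (wavefun q.1)).
apply: eq_ae_cintegral => //; apply: filterS2 Hp Hq => s -> ->.
rewrite rmorphM mulrCA mulrA; congr (_ * _ * _).
exact/esym/conjc_real.
Qed.

(** For a fixed partner the symmetry relation is a closed condition, so it extends to the closure in
    one argument and then in the other. *)
Lemma symmetric_closure (A : operator) : symmetric_op A -> symmetric_op (closure A).
Proof.
move=> symA.
have cl (q : fock * fock) :
    closed [set p : fock * fock | inner p.1 q.2 = inner p.2 q.1].
  (* Equality of complex numbers becomes the vanishing of two continuous real functions. *)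
  have -> : [set p : fock * fock | inner p.1 q.2 = inner p.2 q.1] =
      (fun p => rinner p.1 q.2 - rinner p.2 q.1) @^-1` [set 0] `&`
      (fun p => rinner p.1 (- 'i *: q.2) - rinner p.2 (- 'i *: q.1)) @^-1` [set 0].
    apply/seteqP; split => p /=; rewrite -!Im_inner /rinner.
      by move=> ->; rewrite !subrr.
    move=> [/eqP + /eqP]; rewrite !subr_eq0 => /eqP + /eqP.
    by case: (inner _ _) => u v; case: (inner _ _) => u' v' /= -> ->.
  have ct (y z : fock) : continuous (fun p : fock * fock => rinner p.1 y - rinner p.2 z).
    move=> p; apply: cvgB; apply: cvg_rinner; [exact: cvg_fst|exact: cvg_cst|
      exact: cvg_snd|exact: cvg_cst].
  by apply: closedI; apply: closed_comp => //; exact: closed_eq.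
have swap (p q : fock * fock) : inner p.1 q.2 = inner p.2 q.1 -> inner q.1 p.2 = inner q.2 p.1.
  by move=> pq; rewrite -[LHS]conj_inner -[RHS]conj_inner pq.
have step q p : A q -> closure A p -> inner p.1 q.2 = inner p.2 q.1.
  move=> Aq; rewrite closureE => Ap.
  exact: (Ap _ (conj (cl q) (fun p' Ap' => symA p' q Ap' Aq))).
move=> p q clp; rewrite closureE => Aq; apply: (swap q p).
exact: (Aq [set r | inner r.1 p.2 = inner r.2 p.1]
  (conj (cl p) (fun q' Aq' => swap _ _ (step q' p Aq' clp)))).
Qed.

Lemma symmetric_interaction m g t : symmetric_op (interaction m g t).
Proof.
apply: symmetric_closure => p q [Dp Vp] [Dq Vq].
by rewrite Vq// -conj_inner Vp// interaction_form_conj.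
Qed.

Lemma symmetric_hamiltonian m g t : symmetric_op (hamiltonian m g t).
Proof.
apply: symmetric_operator_add; first exact: symmetric_free_hamiltonian.
exact: symmetric_interaction.
Qed.
End Schrodinger.

(** * The free evolution as multiplication by phases *)

Section FreeEvolution.
Context (R : realType) (m : R).
Local Open Scope complex_scope.
Local Open Scope quotient_scope.
Local Notation C := R[i].
Local Notation fock := (fock R).
Local Notation mu := (fock_measure R).
Local Notation normc := (@Normc.normc R).
Local Notation energy := (free_energy m).
Implicit Types (f g : fockfun R) (x y z : fock) (a : C).

Lemma fock_ext x y : (\forall s \ae mu, wavefun x s = wavefun y s) -> x = y.
Proof. by move=> xy; rewrite -[x]reprK -[y]reprK; apply/eqP/fock_eqP. Qed.

Lemma wavefun_free M t x : \forall s \ae mu,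
  wavefun (free_evolution m M t x) s = expi (t * (energy s + M)) * wavefun x s.
Proof. exact: wavefunK. Qed.

Lemma free_evolution_linear M t : linear (free_evolution m M t).
Proof.
move=> a x y; apply: fock_ext; near=> s.
have -> : wavefun (free_evolution m M t (a *: x + y)) s =
    expi (t * (energy s + M)) * wavefun (a *: x + y) s.
  by near: s; exact: wavefun_free.
have -> : wavefun (a *: x + y) s = a * wavefun x s + wavefun y s.
  by near: s; exact: wavefun_lin.
have -> : wavefun (a *: free_evolution m M t x + free_evolution m M t y) s =
    a * wavefun (free_evolution m M t x) s + wavefun (free_evolution m M t y) s.
  by near: s; exact: wavefun_lin.
have -> : wavefun (free_evolution m M t x) s = expi (t * (energy s + M)) * wavefun x s.
  by near: s; exact: wavefun_free.
have -> : wavefun (free_evolution m M t y) s = expi (t * (energy s + M)) * wavefun y s.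
  by near: s; exact: wavefun_free.
by rewrite mulrDr mulrCA.
Unshelve. all: by end_near.
Qed.

Lemma free_evolutionD M t r x :
  free_evolution m M t (free_evolution m M r x) = free_evolution m M (t + r) x.
Proof.
apply: fock_ext; apply: filterS3 (wavefun_free M t (free_evolution m M r x))
  (wavefun_free M r x) (wavefun_free M (t + r) x) => s -> -> ->.
by rewrite mulrA -expiD -mulrDl.
Qed.

Lemma free_evolution0 M x : free_evolution m M 0 x = x.
Proof.
apply: fock_ext; apply: filterS (wavefun_free M 0 x) => s ->.
by rewrite mul0r expi0 mul1r.
Qed.

Lemma free_evolutionK M t : cancel (free_evolution m M t) (free_evolution m M (- t)).
Proof. by move=> x; rewrite free_evolutionD addNr free_evolution0. Qed.

Lemma wavefunZ a x : \forall s \ae mu, wavefun (a *: x) s = a * wavefun x s.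
Proof. exact: wavefunK. Qed.

(** Isolates M as a scalar phase, which [unshifted_propagator] absorbs later. *)
Lemma free_evolution_shift M t x :
  free_evolution m M t x = expi (M * t) *: free_evolution m 0 t x.
Proof.
apply: fock_ext; apply: filterS3 (wavefun_free M t x)
  (wavefun_free 0 t x) (wavefunZ (expi (M * t)) (free_evolution m 0 t x)) => s -> h ->.
by rewrite h mulrA -expiD addr0 mulrDr addrC [M * t]mulrC.
Qed.

Lemma free_evolution_adjoint M t :
  is_adjoint (free_evolution m M t) (free_evolution m M (- t)).
Proof.
move=> x y.
set x' := free_evolution m M (- t) x; set y' := free_evolution m M t y.
have [? ?] := cintegrable_measurable (cintegrable_pairing (wavefun x) (wavefun y')).
have [? ?] := cintegrable_measurable (cintegrable_pairing (wavefun x') (wavefun y)).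
apply: eq_ae_cintegral => //.
apply: filterS2 (wavefun_free M (- t) x) (wavefun_free M t y) => s -> ->.
rewrite rmorphM mulrCA mulrA; congr (_ * _ * _).
by rewrite [RHS]conjc_expi mulNr opprK.
Qed.

Lemma free_evolution_unitary M t : unitary (free_evolution m M t).
Proof.
split; first exact: free_evolution_linear.
exists (free_evolution m M (- t)); split.
- exact: free_evolution_adjoint.
- exact: free_evolutionK.
- by move=> x; rewrite free_evolutionD subrr free_evolution0.
Qed.

Lemma le_finite_norm (p q : config R -> R) :
  measurable_fun setT p -> measurable_fun setT q ->
  (forall s, 0 <= p s <= q s) -> finite_norm mu 2%:E q -> finite_norm mu 2%:E p.
Proof.
move=> mp mq pq; apply: le_lt_trans; rewrite unlock /Lnorm.
have mN (h : config R -> R) : measurable_fun setT h ->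
    measurable_fun setT (fun s => `|(h s)%:E| `^ 2)%E.
  move=> mh; apply: (measurableT_comp (measurable_poweR _)).
  by apply: measurableT_comp => //; exact/measurable_EFinP.
apply: gt0_ler_poweR.
- by rewrite invr_ge0.
- by rewrite in_itv/= leey andbT integral_ge0// => s _; exact: poweR_ge0.
- by rewrite in_itv/= leey andbT integral_ge0// => s _; exact: poweR_ge0.
apply: ge0_le_integral => //.
- by move=> s ?; exact: poweR_ge0.
- exact: mN.
- exact: mN.
move=> s _; have /andP[p0 spq] := pq s.
apply: gt0_ler_poweR => //=; rewrite ?in_itv/= ?leey ?andbT ?lee_fin//.
by rewrite !ger0_norm//; exact: le_trans spq.
Qed.

(** Invariance under permutations keeps products with wave functions symmetric. *)
Definition multiplier (q : config R -> R) : Prop :=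
  measurable_fun setT q /\ forall s t : seq R, perm_eq s t -> q s = q t.

Lemma mul_fockfun_subproof q f (c : R) : multiplier q ->
  (forall s, normc ((q s)%:C * f s) <= c * normc (f s)) ->
  (fun s => (q s)%:C * f s) \in @fockfun_pred R.
Proof.
move=> [mq sq] qf; have [fr fi fs fn] := fockfunP f.
have hr : measurable_fun setT (fun s => complex.Re ((q s)%:C * f s)).
  rewrite (_ : (fun s => _) = (fun s => q s * complex.Re (f s))).
    exact: measurable_funM.
  by apply/funext => s; case: (f s) => u v /=; rewrite mul0r subr0.
have hi : measurable_fun setT (fun s => complex.Im ((q s)%:C * f s)).
  rewrite (_ : (fun s => _) = (fun s => q s * complex.Im (f s))).
    exact: measurable_funM.
  by apply/funext => s; case: (f s) => u v /=; rewrite mul0r addr0.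
have [cr ci _ cn] := fockfunP (c%:C *: f).
rewrite inE; split => //; first by move=> s t st; rewrite (sq _ _ st) (fs _ _ st).
apply: le_finite_norm cn; [exact: measurable_normc|exact: measurable_normc|].
move=> s; rewrite normc_ge0 /=; apply: le_trans (qf s) _.
rewrite [leRHS]Normc.normcM ler_wpM2r ?normc_ge0//.
by rewrite /= expr0n addr0 sqrtr_sqr ler_norm.
Qed.

End FreeEvolution.

(** * Vectors of bounded energy: invariance, smoothness and density *)

Section BoundedEnergy.
Context (R : realType) (m : R).
Local Open Scope complex_scope.
Local Open Scope quotient_scope.
Local Notation C := R[i].
Local Notation fock := (fock R).
Local Notation mu := (fock_measure R).
Local Notation normc := (@Normc.normc R).
Local Notation energy := (free_energy m).
Implicit Types (f g : fockfun R) (x y z : fock) (a : C).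

Lemma ler_rnorm_ae x y (c : R) : 0 <= c ->
  (\forall s \ae mu, normc (wavefun x s) <= c * normc (wavefun y s)) ->
  rnorm x <= c * rnorm y.
Proof.
move=> c0 xy; rewrite -ler_sqr ?nnegrE ?mulr_ge0 ?rnorm_ge0//.
rewrite exprMn !rnorm_sqr -RintegralZl//; last exact: integrable_normc2.
have ix := integrable_normc2 (wavefun x).
have iy : mu.-integrable setT (EFin \o (fun s => c ^+ 2 * normc (wavefun y s) ^+ 2)).
  exact: (integrableZl _ (c ^+ 2) (integrable_normc2 (wavefun y))).
rewrite /Rintegral fine_le ?integrable_fin_num//.
apply: ae_ge0_le_integral => //.
- by move=> s _; rewrite lee_fin sqr_ge0.
- by case/integrableP: ix.
- by move=> s _; rewrite lee_fin mulr_ge0// sqr_ge0.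
- by case/integrableP: iy.
apply: filterS xy => s xys _.
by rewrite lee_fin -exprMn ler_sqr ?nnegrE ?mulr_ge0 ?normc_ge0.
Qed.

Lemma wavefunB x y : \forall s \ae mu, wavefun (x - y) s = wavefun x s - wavefun y s.
Proof.
have -> : x - y = -1 *: y + x by rewrite scaleN1r addrC.
apply: filterS (wavefun_lin (-1) y x) => s ->.
by rewrite addrC -[wavefun y s]mul1r -mulNr.
Qed.

Lemma free_energy_ge0 s : 0 <= energy s.
Proof. by apply: sumr_ge0 => k _; exact: sqrtr_ge0. Qed.

Lemma multiplier_indic (n : R) : multiplier (fun s => (energy s <= n)%R%:R).
Proof.
split; last by move=> s t st; rewrite /free_energy (perm_big _ st).
have -> : (fun s => (energy s <= n)%R%:R) = \1_[set s | energy s <= n] :> (config R -> R).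
  by apply/funext => s; rewrite indicE; congr (nat_of_bool _)%:R; apply/idP/idP; rewrite inE.
apply: measurable_indic.
have -> : [set s | energy s <= n] = setT `&` energy @^-1` `]-oo, n].
  by apply/seteqP; split => s /=; rewrite in_itv/= => // -[].
exact: (@measurable_free_energy _ m measurableT _ (measurable_itv _)).
Qed.

Lemma multiplier_energy (n : R) :
  multiplier (fun s => energy s * (energy s <= n)%R%:R).
Proof.
have [mi si] := multiplier_indic n.
split; last by move=> s t st; rewrite /free_energy !(perm_big _ st).
by apply: measurable_funM => //; exact: measurable_free_energy.
Qed.

Let normc_real (c : R) : normc c%:C = `|c|.
Proof. by rewrite /= expr0n addr0 sqrtr_sqr. Qed.

Lemma truncation_subproof n f :
  (fun s => ((energy s <= n)%R%:R : R)%:C * f s) \in @fockfun_pred R.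
Proof.
apply: (@mul_fockfun_subproof _ _ _ 1 (multiplier_indic n)) => s.
rewrite Normc.normcM normc_real mul1r ler_piMl ?normc_ge0//.
by case: (energy s <= n); rewrite ?normr1 ?normr0.
Qed.

Definition truncation n x : fock := \pi_fock (FockFun (truncation_subproof n (wavefun x))).

Lemma truncated_energy_subproof n f :
  (fun s => (energy s * (energy s <= n)%R%:R : R)%:C * f s) \in @fockfun_pred R.
Proof.
apply: (@mul_fockfun_subproof _ _ _ `|n| (multiplier_energy n)) => s.
rewrite Normc.normcM normc_real ler_wpM2r ?normc_ge0//.
case: (leP (energy s) n) => [En|_]; last by rewrite mulr0 normr0.
by rewrite mulr1 ger0_norm ?free_energy_ge0// (le_trans En)// ler_norm.
Qed.

Definition truncated_energy n x : fock :=
  \pi_fock (FockFun (truncated_energy_subproof n (wavefun x))).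

Definition bounded_energy (n : R) x : Prop :=
  \forall s \ae mu, n < energy s -> wavefun x s = 0.

Lemma wavefun_truncation n x : \forall s \ae mu,
  wavefun (truncation n x) s = ((energy s <= n)%R%:R : R)%:C * wavefun x s.
Proof. exact: wavefunK. Qed.

Lemma wavefun_truncated_energy n x : \forall s \ae mu,
  wavefun (truncated_energy n x) s =
  (energy s * (energy s <= n)%R%:R : R)%:C * wavefun x s.
Proof. exact: wavefunK. Qed.

Lemma bounded_energy_truncation n x : bounded_energy n (truncation n x).
Proof.
by apply: filterS (wavefun_truncation n x) => s ->; rewrite ltNge => /negbTE ->; rewrite mul0r.
Qed.

Lemma bounded_energy_truncated_energy n x : bounded_energy n (truncated_energy n x).
Proof.
apply: filterS (wavefun_truncated_energy n x) => s ->; rewrite ltNge => /negbTE ->.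
by rewrite mulr0 mul0r.
Qed.

Lemma free_hamiltonian_bounded_energy n x : bounded_energy n x ->
  free_hamiltonian m (x, truncated_energy n x).
Proof.
move=> bx; apply: filterS2 bx (wavefun_truncated_energy n x) => s /= h ->.
by case: (leP (energy s) n) h => [_ _|_ ->//]; rewrite ?mulr1// !mulr0.
Qed.

(** H_0 preserves the energy bound, so it can be applied any number of times. *)
Lemma bounded_energy_smooth n x : bounded_energy n x -> smooth_domain m x.
Proof.
move=> bx k _; elim: k x bx => [//|k IH] x bx /=.
exists (truncated_energy n x); first exact: free_hamiltonian_bounded_energy.
by apply: IH; exact: bounded_energy_truncated_energy.
Qed.

Lemma bounded_energy_free n M t x : bounded_energy n x ->
  bounded_energy n (free_evolution m M t x).
Proof.
move=> bx; apply: filterS2 bx (wavefun_free m M t x) => s h -> /h ->.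
by rewrite mulr0.
Qed.

(** On energies at most n the difference quotient of the phase has error at most 2 n^2 |h|,
    uniformly over configurations, so the pointwise estimate integrates to one in norm. *)
Lemma schrodinger_free n s t x : bounded_energy n x ->
  schrodinger s (fun r => free_evolution m 0 (- (r - s)) x) t
    (truncated_energy n (free_evolution m 0 (- (t - s)) x)).
Proof.
move=> bx; set y := free_evolution m 0 (- (t - s)) x.
have by_ : bounded_energy n y by exact: bounded_energy_free.
rewrite /schrodinger; apply: cvg_rdist_bound (cvg_norm_increment s t (2 * n ^+ 2 * rnorm y)).
apply: filterS (forward_increments_neq0 s t) => h h0.
have -> : free_evolution m 0 (- (t + h - s)) x = free_evolution m 0 (- h) y.
  by rewrite free_evolutionD; congr free_evolution; ring.
rewrite mulrAC; apply: ler_rnorm_ae.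
  by apply: mulr_ge0 => //; apply: mulr_ge0 => //; exact: sqr_ge0.
set z := 'i / h%:C *: (free_evolution m 0 (- h) y - y).
near=> r.
have -> : wavefun (truncated_energy n y - z) r = wavefun (truncated_energy n y) r - wavefun z r.
  by near: r; exact: wavefunB.
have -> : wavefun z r = 'i / h%:C * (wavefun (free_evolution m 0 (- h) y) r - wavefun y r).
  near: r; apply: filterS2 (wavefunZ ('i / h%:C) (free_evolution m 0 (- h) y - y))
    (wavefunB (free_evolution m 0 (- h) y) y) => r -> ->.
  by [].
have -> : wavefun (free_evolution m 0 (- h) y) r = expi (- h * (energy r + 0)) * wavefun y r.
  by near: r; exact: wavefun_free.
have -> : wavefun (truncated_energy n y) r = (energy r)%:C * wavefun y r.
  by near: r; exact: (free_hamiltonian_bounded_energy by_).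
have byr : n < energy r -> wavefun y r = 0 by near: r.
have -> : (energy r)%:C * wavefun y r -
    'i / h%:C * (expi (- h * (energy r + 0)) * wavefun y r - wavefun y r) =
    (- (- energy r)%:C - ('i / h%:C) * (expi (- energy r * h) - 1)) * wavefun y r.
  by rewrite rmorphN opprK addr0 mulNr [- energy r * h]mulNr [h * _]mulrC; ring.
(* Above energy n the vector vanishes; below, [expi_quotient] applies with a the opposite of the
   energy. *)
rewrite Normc.normcM; have [/byr->|En] := ltP n (energy r).
  by rewrite Normc.normc0 !mulr0.
rewrite ler_wpM2r ?normc_ge0//; apply: le_trans (expi_quotient _ h0) _.
rewrite ler_wpM2r// ler_wpM2l// sqrrN ler_sqr ?nnegrE ?free_energy_ge0//.
by apply: le_trans En; exact: free_energy_ge0.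
Unshelve. all: by end_near.
Qed.

(** Dominated convergence for the squared error: every configuration has finite energy, so the error
    there is 0 for large n, and |x|^2 dominates it. *)
Lemma cvg_truncation x : truncation n%:R x @[n --> \oo] --> x.
Proof.
pose d n (s : config R) : R := (1 - (energy s <= n%:R)%R%:R) * normc (wavefun x s) ^+ 2.
have ix := integrable_normc2 (wavefun x).
have mx : measurable_fun setT (fun s => normc (wavefun x s) ^+ 2).
  by apply/measurable_EFinP; case/integrableP: ix.
have md n : measurable_fun setT (d n).
  apply: measurable_funM => //; apply: measurable_funB => //.
  exact: (multiplier_indic n%:R).1.
have rd n : rnorm (x - truncation n%:R x) ^+ 2 = Rintegral mu setT (d n).
  have [fr fi _ _] := fockfunP (wavefun (x - truncation n%:R x)).
  rewrite rnorm_sqr; apply: eq_ae_Rintegral => //.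
    by apply: measurable_funX; exact: measurable_normc.
  apply: filterS2 (wavefunB x (truncation n%:R x)) (wavefun_truncation n%:R x) => s -> ->.
  rewrite /d; case: (energy s <= n%:R); first by rewrite mul1r !subrr Normc.normc0 expr0n mul0r.
  by rewrite mul0r !subr0 mul1r.
have d0 : {ae mu, forall s, setT s -> (fun n => (d n s)%:E) @ \oo --> 0%E}.
  apply: nearW => s _; apply: cvg_near_cst; near=> n.
  have En : energy s <= n%:R by near: n; exact: nbhs_infty_ger.
  by rewrite /d En subrr mul0r.
have dle : {ae mu, forall s n, setT s ->
    (`|(d n s)%:E| <= (normc (wavefun x s) ^+ 2)%:E)%E}.
  apply: nearW => s n _; rewrite lee_fin /d.
  have w0 : 0 <= normc (wavefun x s) ^+ 2 by exact: sqr_ge0.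
  case: (energy s <= n%:R); first by rewrite subrr mul0r normr0.
  by rewrite subr0 mul1r ger0_norm.
have [_ _ dom] := @dominated_convergence _ _ _ mu setT measurableT
  (fun n => EFin \o d n) (cst 0%E) (EFin \o (fun s => normc (wavefun x s) ^+ 2))
  (fun n => (measurable_EFinP _ _).2 (md n)) (measurable_cst _) d0 ix dle.
have {}dom : Rintegral mu setT (d n) @[n --> \oo] --> 0.
  by apply: fine_cvg; move: dom; rewrite integral0.
apply/cvg_rdist => e e0; move/cvgr0Pnorm_lt : dom => /(_ _ (exprn_gt0 2 e0)).
apply: filterS => n; rewrite -rd ger0_norm ?sqr_ge0//.
by rewrite ltr_sqr ?nnegrE ?rnorm_ge0// ltW.
Unshelve. all: by end_near.
Qed.
End BoundedEnergy.

(** * Unitary operators and their determination on a dense set *)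

Section Unitary.
Context (R : realType).
Local Open Scope complex_scope.
Local Notation fock := (fock R).
Implicit Types (A B : fock -> fock) (x y : fock).

Lemma unitary_comp A B : unitary A -> unitary B -> unitary (A \o B).
Proof.
move=> [linA [A' [adjA AK A'K]]] [linB [B' [adjB BK B'K]]]; split.
  by move=> a x y /=; rewrite linB linA.
exists (B' \o A'); split.
- by move=> x y /=; rewrite adjA adjB.
- exact: can_comp.
- exact: can_comp.
Qed.

Lemma unitary_scale (a : R) : unitary (fun x : fock => expi a *: x).
Proof.
have eK : expi (- a) * expi a = 1 by rewrite -expiD addNr expi0.
split.
  by move=> c x y; rewrite scalerDr !scalerA mulrC.
exists (fun x => expi (- a) *: x); split.
- by move=> x y; rewrite innerZr innerZl conjc_expi opprK.
- by move=> x; rewrite scalerA eK scale1r.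
- by move=> x; rewrite scalerA mulrC eK scale1r.
Qed.

Lemma unitary_rnorm A : unitary A -> forall x, rnorm (A x) = rnorm x.
Proof.
move=> [_ [A' [adjA AK _]]]; apply: inner_preserving_rnorm => x y.
by rewrite adjA AK.
Qed.

Lemma linear_fun_sub A : linear A -> forall x y, A (x - y) = A x - A y.
Proof. by move=> linA x y; rewrite addrC -scaleN1r linA scaleN1r addrC. Qed.

Lemma linear_fun_scale A : linear A -> forall a x, A (a *: x) = a *: A x.
Proof.
move=> linA a x; have A0 : A 0 = 0 by rewrite -[0 in LHS](subrr 0) linear_fun_sub// subrr.
by rewrite -[a *: x]addr0 linA A0 addr0.
Qed.

(** Density and isometry: for y of bounded energy within e / 2 of x, A x - B x = A (x - y) + B (y -
    x) has norm at most e. *)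
Lemma eq_unitary_bounded_energy m A B : unitary A -> unitary B ->
  (forall n x, bounded_energy m n x -> A x = B x) -> A =1 B.
Proof.
move=> uA uB AB x; apply/subr0_eq/rnorm_eq0/eqP; rewrite eq_le rnorm_ge0 andbT.
apply/ler_addgt0Pr => e e0; rewrite add0r.
have /cvg_rdist/(_ _ (divr_gt0 e0 (ltr0n R 2))) := @cvg_truncation R m x.
move=> /filter_ex[n xn]; pose y := truncation m n%:R x.
have ABy : A y = B y by apply: AB; exact: bounded_energy_truncation.
have -> : A x - B x = A (x - y) + B (y - x).
  by rewrite (linear_fun_sub uA.1) (linear_fun_sub uB.1) ABy addrA subrK.
apply: le_trans (ler_rnormD _ _) _.
rewrite (unitary_rnorm uA) (unitary_rnorm uB) -(rnormN (y - x)) opprB.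
by rewrite [leRHS]splitr lerD// ltW.
Qed.
End Unitary.

(** * Propagators, with and without interaction *)

Section Propagator.
Context (R : realType) (m : R).
Local Open Scope complex_scope.
Local Notation fock := (fock R).
Implicit Types (g : R * R -> R) (x y : fock) (U : R -> R -> fock -> fock).

Definition silent g (t : R) : Prop := forall z, g (z, t) = 0.

Lemma cintegral0 d (T : measurableType d) (mu : {measure set T -> \bar R}) :
  cintegral mu (fun=> 0) = 0.
Proof. by rewrite /cintegral /Rintegral /= integral0. Qed.

(** The interaction form vanishes at a silent time, so 0 represents V_g(t) x and H_g(t) acts as
    H_0. *)
Lemma silent_hamiltonian g t n x : silent g t -> bounded_energy m n x ->
  hamiltonian m g t (x, truncated_energy m n x).
Proof.
move=> gt bx; exists (truncated_energy m n x), 0; split; last by rewrite addr0.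
  exact: free_hamiltonian_bounded_energy.
apply: subset_closure; split; first exact: bounded_energy_smooth bx.
move=> phi _; rewrite inner0r /interaction_form -[LHS](cintegral0 (@lebesgue_measure R)).
by congr cintegral; apply/funext => z; rewrite gt mul0r.
Qed.

Lemma eq_hamiltonian g g' t : (forall z, g (z, t) = g' (z, t)) ->
  hamiltonian m g t = hamiltonian m g' t.
Proof.
move=> gg'; congr operator_add; congr closure; apply/seteqP.
have E phi x : interaction_form m g t phi x = interaction_form m g' t phi x.
  by congr cintegral; apply/funext => z; rewrite gg'.
by split => p [Dp Vp]; split => // phi /Vp; rewrite E.
Qed.

(** The phase removes M, leaving an evolution generated by H_g(t) alone; propagators with different
    constants thus become comparable. *)
Definition unshifted_propagator (M : R) U (t s : R) x : fock :=
  expi (M * (t - s)) *: U t s x.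

Section OnePropagator.
Context g (M : R) U (propU : is_propagator m g M U).
Local Notation W := (unshifted_propagator M U).
Local Notation P := (interaction_propagator m M U).

Lemma unshifted_propagator_unitary s t : s <= t -> unitary (W t s).
Proof.
move=> st; have [uU _ _ _ _] := propU.
exact: (unitary_comp (unitary_scale _) (uU _ _ st)).
Qed.

Lemma unshifted_propagator_id s : W s s =1 id.
Proof.
have [_ _ U1 _ _] := propU; move=> x.
by rewrite /unshifted_propagator U1 subrr mulr0 expi0 scale1r.
Qed.

Lemma unshifted_propagator_solution s t x chi0 : s <= t ->
  hamiltonian m g s (x, chi0) ->
  exists2 chi, scalar_hull (hamiltonian m g t) (W t s x, chi) &
    schrodinger s (fun r => W r s x) t chi.
Proof.
have [_ _ _ _ dU] := propU; move=> st Hx.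
have domx : dom (shifted_hamiltonian m g M s) x.
  by exists (chi0 + M%:C *: x), chi0, (M%:C *: x); split.
have [chi [chi1 [chi2 [/= H1 H2 ->]]] dUx] := dU _ _ _ st domx.
have := @schrodinger_phase R s (fun r => U r s x) t (chi1 + chi2) M dUx.
have -> : chi2 = M%:C *: U t s x by exact: H2.
rewrite addrK => {}dUx.
exists (expi (M * (t - s)) *: chi1) => //.
by exists (expi (M * (t - s))), (U t s x, chi1).
Qed.

(** The phases at M t and - M s taken from the two free evolutions multiply to the one in
    [unshifted_propagator]. *)
Lemma interaction_propagatorE s t x : s <= t ->
  P t s x = free_evolution m 0 t (W t s (free_evolution m 0 (- s) x)).
Proof.
move=> st; have [/(_ _ _ st)[linU _] _ _ _ _] := propU.
have linF := @free_evolution_linear R m 0 t.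
rewrite /interaction_propagator free_evolution_shift.
rewrite [free_evolution m M (- s) x]free_evolution_shift.
rewrite (linear_fun_scale linU) !(linear_fun_scale linF) scalerA -expiD.
by rewrite -mulrDr.
Qed.

Lemma interaction_propagator_unitary s t : s <= t -> unitary (P t s).
Proof.
move=> st; have -> : P t s = free_evolution m 0 t \o (W t s \o free_evolution m 0 (- s)).
  by apply/funext => x; exact: interaction_propagatorE.
apply: unitary_comp; first exact: free_evolution_unitary.
apply: unitary_comp; first exact: unshifted_propagator_unitary.
exact: free_evolution_unitary.
Qed.

Lemma interaction_propagator_comp r s t x : r <= s -> s <= t ->
  P t s (P s r x) = P t r x.
Proof.
move=> rs st; have [_ UU _ _ _] := propU.
by rewrite /interaction_propagator free_evolutionK -(UU _ _ _ rs st).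
Qed.

(** From a vector of bounded energy both sides solve the equation of H_g, which acts as H_0 there;
    [rinner_conserved] and [eq_of_rinner] identify them, and density extends this to all vectors. *)
Lemma unshifted_propagator_silent s t : s <= t ->
  (forall r, s <= r <= t -> silent g r) ->
  W t s =1 free_evolution m 0 (- (t - s)).
Proof.
move=> st sg; apply: (@eq_unitary_bounded_energy _ m).
- exact: unshifted_propagator_unitary.
- exact: free_evolution_unitary.
move=> n x bx.
have [ss tt] : s <= s <= t /\ s <= t <= t by rewrite !lexx st.
apply: eq_of_rinner.
  rewrite (unitary_rnorm (unshifted_propagator_unitary st)).
  by rewrite (unitary_rnorm (free_evolution_unitary _ _ _)).
rewrite (unitary_rnorm (unshifted_propagator_unitary st)) -rinner_self.
rewrite (@rinner_conserved _ s t (fun r => W r s x)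
  (fun r => free_evolution m 0 (- (r - s)) x)
  (fun r => scalar_hull (hamiltonian m g r)) st) /=.
(* Both solutions start from x, so the conserved value is |x|^2. *)
- by rewrite unshifted_propagator_id subrr oppr0 free_evolution0.
- by move=> r; apply: symmetric_scalar_hull; exact: symmetric_hamiltonian.
- move=> r /andP[sr _]; apply: (unshifted_propagator_solution sr).
  exact: silent_hamiltonian (sg _ ss) bx.
- move=> r srt; exists (truncated_energy m n (free_evolution m 0 (- (r - s)) x)).
    exists 1, (free_evolution m 0 (- (r - s)) x,
      truncated_energy m n (free_evolution m 0 (- (r - s)) x)).
    split; last by rewrite !scale1r.
    by apply: silent_hamiltonian (sg _ srt) _; exact: bounded_energy_free.
  exact: schrodinger_free.
Qed.

Lemma interaction_propagator_silent s t : s <= t ->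
  (forall r, s <= r <= t -> silent g r) -> P t s =1 id.
Proof.
move=> st sg x; rewrite interaction_propagatorE// unshifted_propagator_silent//.
by rewrite !free_evolutionD (_ : _ + _ = 0) ?free_evolution0//; ring.
Qed.

(** For t >= b and s <= a the propagator factors through b and a, and the outer factors are the
    identity: the filter is eventually constant. *)
Lemma cvg_interaction_propagator (a b : R) x : a <= b ->
  (forall r, r <= a -> silent g r) -> (forall r, b <= r -> silent g r) ->
  interaction_filter m M U x --> P b a x.
Proof.
move=> ab sa sb; apply: cvg_near_cst.
exists ([set t | b <= t], [set s | s <= a]).
  by split; [exact: (nbhs_pinfty_ge (num_real b))|exact: (nbhs_ninfty_le (num_real a))].
move=> [t s] /= [bt sa'].
rewrite -(@interaction_propagator_comp s a t)//; last exact: le_trans bt.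
rewrite -(@interaction_propagator_comp a b t)//.
rewrite [P a s x]interaction_propagator_silent//; last first.
  by move=> r /andP[_ ?]; exact: sa.
by rewrite interaction_propagator_silent// => r /andP[? _]; exact: sb.
Qed.

Lemma bogoliubovE (a b : R) : a <= b ->
  (forall r, r <= a -> silent g r) -> (forall r, b <= r -> silent g r) ->
  bogoliubov m M U = P b a.
Proof.
move=> ab sa sb; apply/funext => x; apply: cvg_lim; first exact: norm_hausdorff.
exact: cvg_interaction_propagator.
Qed.
End OnePropagator.

(** Silence at s puts the vectors of bounded energy in the domain of both Hamiltonians at the
    initial time; afterwards both evolutions have the same generator, so uniqueness applies. *)
Lemma eq_interaction_propagator g g' M M' U U' s t :
  is_propagator m g M U -> is_propagator m g' M' U' -> s <= t ->
  (forall r z, s <= r <= t -> g (z, r) = g' (z, r)) -> silent g s ->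
  interaction_propagator m M U t s = interaction_propagator m M' U' t s.
Proof.
move=> pU pU' st gg' sg; apply/funext => x.
rewrite (interaction_propagatorE pU)// (interaction_propagatorE pU')//.
congr free_evolution; move: (free_evolution m 0 (- s) x) => {}x.
have uW := unshifted_propagator_unitary pU st.
have uW' := unshifted_propagator_unitary pU' st.
move: x; apply: (@eq_unitary_bounded_energy _ m _ _ uW uW') => n x bx.
have ss : s <= s <= t by rewrite lexx.
have sg' : silent g' s by move=> z; rewrite -gg'.
apply: eq_of_rinner; first by rewrite (unitary_rnorm uW) (unitary_rnorm uW').
rewrite (unitary_rnorm uW) -rinner_self.
rewrite (@rinner_conserved _ s t (fun r => unshifted_propagator M U r s x)
  (fun r => unshifted_propagator M' U' r s x)
  (fun r => scalar_hull (hamiltonian m g r)) st) /=.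
- by rewrite (unshifted_propagator_id pU) (unshifted_propagator_id pU').
- by move=> r; apply: symmetric_scalar_hull; exact: symmetric_hamiltonian.
- move=> r /andP[sr _]; apply: (unshifted_propagator_solution pU sr).
  exact: silent_hamiltonian bx.
- move=> r srt; rewrite (eq_hamiltonian (gg' r ^~ srt)).
  have /andP[sr _] := srt; apply: (unshifted_propagator_solution pU' sr).
  exact: silent_hamiltonian bx.
Qed.
End Propagator.

(** * Time extent of the supports of switching functions *)

Section Switching.
Context (R : realType).
Implicit Types (g : R * R -> R) (K : set (R * R)).

Lemma smooth_add g1 g2 : smooth g1 -> smooth g2 -> smooth (g1 \+ g2).
Proof.
move=> s1 s2 vs.
have -> : foldr (fun v f q => 'D_v f q) (g1 \+ g2) vs =
    foldr (fun v f q => 'D_v f q) g1 vs \+ foldr (fun v f q => 'D_v f q) g2 vs.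
  elim: vs => [//|v vs IH] /=; apply/funext => q; rewrite IH /=.
  by apply: deriveD; apply: diff_derivable; [exact: s1|exact: s2].
by move=> p; apply: differentiableD; [exact: s1|exact: s2].
Qed.

Lemma supp_eq0 g (p : R * R) : ~ supp g p -> g p = 0.
Proof.
move=> np; apply/eqP; apply/negP => /negP gp; apply: np.
exact: subset_closure.
Qed.

Lemma switching_add g1 g2 : switching g1 -> switching g2 -> switching (g1 \+ g2).
Proof.
move=> [s1 c1 p1] [s2 c2 p2]; split; first exact: smooth_add.
  apply: (subclosed_compact _ (compactU c1 c2)); first exact: closed_closure.
  rewrite /supp -closureU; apply: closureS => p /=.
  have [->|g1p] := eqVneq (g1 p) 0; last by left.
  by rewrite add0r; right.
by move=> p; rewrite addr_ge0.
Qed.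

Lemma compact_time_max K : compact K -> K !=set0 ->
  exists2 c, K c & forall p, K p -> p.2 <= c.2.
Proof.
move=> cK K0.
have cs : {within K, continuous (snd : R * R -> R)}.
  by apply: continuous_subspaceT => p; exact: cvg_snd.
have [c] := compact_EVT_max K0 cK cs.
by rewrite inE => Kc cmax; exists c => // p Kp; apply: cmax; rewrite inE.
Qed.

Lemma compact_time_min K : compact K -> K !=set0 ->
  exists2 c, K c & forall p, K p -> c.2 <= p.2.
Proof.
move=> cK K0.
have cs : {within K, continuous (snd : R * R -> R)}.
  by apply: continuous_subspaceT => p; exact: cvg_snd.
have [c] := compact_EVT_min K0 cK cs.
by rewrite inE => Kc cmin; exists c => // p Kp; apply: cmin; rewrite inE.
Qed.

Lemma switching_silent g : switching g -> exists2 T, 0 < T &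
  (forall t, t <= - T -> silent g t) /\ (forall t, T <= t -> silent g t).
Proof.
move=> [_ cK _]; have [K0|/set0P/negP/negPn/eqP K0] := pselect (supp g !=set0); last first.
  by exists 1 => //; split => t _ z; apply: supp_eq0; rewrite K0.
have [a Ka amax] := compact_time_max cK K0; have [b Kb bmin] := compact_time_min cK K0.
(* The 1 makes T positive and keeps the support strictly between the times - T and T. *)
exists (1 + `|a.2| + `|b.2|); first by rewrite -addrA ltr_pwDl// addr_ge0.
have := ler_norm a.2; have := ler_norm (- b.2); rewrite normrN => hb ha.
split => t ht z; apply: supp_eq0 => Kz.
  have := bmin _ Kz; have := normr_ge0 a.2; rewrite /=; lra.
have := amax _ Kz; have := normr_ge0 b.2; rewrite /=; lra.
Qed.

Lemma separating_time g1 g2 : switching g1 -> switching g2 ->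
  (forall p1 p2, supp g1 p1 -> supp g2 p2 -> p2.2 < p1.2) ->
  exists T, (forall t, t <= T -> silent g1 t) /\ (forall t, T <= t -> silent g2 t).
Proof.
move=> sw1 sw2 g12; have [_ c1 _] := sw1; have [_ c2 _] := sw2.
(* If one support is empty, any time beyond the other support on the right side will do. *)
have [K1|/set0P/negP/negPn/eqP K1] := pselect (supp g1 !=set0); last first.
  have [T _ [_ hT]] := switching_silent sw2.
  by exists T; split => // t _ z; apply: supp_eq0; rewrite K1.
have [K2|/set0P/negP/negPn/eqP K2] := pselect (supp g2 !=set0); last first.
  have [T _ [hT _]] := switching_silent sw1.
  by exists (- T); split => // t _ z; apply: supp_eq0; rewrite K2.
have [a Ka amin] := compact_time_min c1 K1; have [b Kb bmax] := compact_time_max c2 K2.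
have ba := g12 _ _ Ka Kb.
(* The midpoint between the last time of [supp g2] and the first time of [supp g1]; both functions
   are silent there. *)
exists ((a.2 + b.2) / 2); split => t ht z; apply: supp_eq0 => Kz.
  by have := amin _ Kz; rewrite /=; lra.
by have := bmax _ Kz; rewrite /=; lra.
Qed.
End Switching.

(** * Unitarity and causal factorization of S(g) *)

Unset Implicit Arguments.

Theorem mainTheorem3 (R : realType) (m c : R) (hm : 0 < m) (hc : 0 < c)
    (Mg : (R * R -> R) -> R)
    (hMg : forall g, switching g -> lower_bound m g (Mg g))
    (U : (R * R -> R) -> R -> R -> fock R -> fock R)
    (hU : forall g, switching g -> is_propagator m g (Mg g + c) (U g)) :
  let S g := bogoliubov m (Mg g + c) (U g) in
  (forall g, switching g ->
     (forall psi, cvg (interaction_filter m (Mg g + c) (U g) psi)) /\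
     unitary (S g)) /\
  (forall g1 g2, switching g1 -> switching g2 ->
     (forall p1 p2, supp g1 p1 -> supp g2 p2 -> p2.2 < p1.2) ->
     S (g1 \+ g2) = S g1 \o S g2).
Proof.
move=> S; split=> [g sw|g1 g2 sw1 sw2 g12].
  have [T T0 [sL sR]] := switching_silent sw.
  have TT : - T <= T by lra.
  split=> [psi|].
    apply/cvg_ex; exists (interaction_propagator m (Mg g + c) (U g) T (- T) psi).
    exact: (cvg_interaction_propagator (x := psi) (hU g sw) TT sL sR).
  rewrite /S (bogoliubovE (hU g sw) TT sL sR).
  exact: (interaction_propagator_unitary (hU g sw) TT).
have sw := switching_add sw1 sw2.
have [T [s1 s2]] := separating_time sw1 sw2 g12.
have [T1 T10 [_ s1']] := switching_silent sw1.
have [T2 T20 [s2' _]] := switching_silent sw2.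
(* All of g1 acts between T and b, all of g2 between a and T. *)
have [b Tb T1b] : exists2 b, T <= b & T1 <= b.
  by exists (Num.max T T1); rewrite le_max lexx ?orbT.
have [a aT aT2] : exists2 a, a <= T & a <= - T2.
  by exists (Num.min T (- T2)); rewrite ge_min lexx ?orbT.
rewrite /S.
rewrite (bogoliubovE (hU g1 sw1) Tb s1); last first.
  by move=> r br; apply: s1'; exact: le_trans br.
rewrite (bogoliubovE (hU g2 sw2) aT _ s2); last first.
  by move=> r ra; apply: s2'; exact: le_trans aT2.
rewrite (bogoliubovE (hU _ sw) (le_trans aT Tb)); last 2 first.
- move=> r ra z /=; rewrite s1 ?(le_trans ra)// s2' ?addr0//.
  exact: le_trans aT2.
- move=> r br z /=; rewrite s2 ?(le_trans Tb)// s1' ?addr0//.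
  exact: le_trans br.
apply/funext => psi /=.
(* Cut at T: from T to b the sum g1 + g2 equals g1, from a to T it equals g2, and it is silent at
   both initial times T and a. *)
rewrite -(interaction_propagator_comp (hU _ sw) psi aT Tb).
rewrite (eq_interaction_propagator (hU _ sw) (hU g1 sw1) Tb); last 2 first.
- by move=> r z /andP[Tr _] /=; rewrite s2// addr0.
- by move=> z /=; rewrite s1// s2// addr0.
rewrite (eq_interaction_propagator (hU _ sw) (hU g2 sw2) aT)//.
- by move=> r z /andP[_ rT] /=; rewrite s1// add0r.
- by move=> z /=; rewrite s1// s2'// addr0.
Qed.
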